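(* For every constant $c_T\ge2$ there exist a sufficiently large constant $C=C(c_T)$ and positive constants $a_1,a_2$ (depending at most on $c_T$) such that the following holds. Let $\delta\in(0,0.5)$ and assume: $d\ge Cn^2\log(n/\delta)$; $n\ge C\log(1/\delta)$; $\rho\ge C\sqrt{d/n}$; $0\le\eta\le1/C$; and $2\le T\le c_T$. For $\gamma>0$ let $(\bm v_\gamma,\bm p_\gamma)$ be a solution of $$\min_{\bm v,\bm p\in\mathbb R^d}\ \|\bm p\|^2+\|\bm v\|^2\quad\text{s.t.}\quad \min_{i\in[n]}y_if(\bm X_i;\bm v,\bm p)\ge\gamma .$$ Then there exists $\gamma_0$ such that for any $\gamma\ge\gamma_0$, with probability at least $1-\delta$ over the training set of $n$ i.i.d. samples from $\mathcal D$: (i) $y_i=\operatorname{sign}(f(\bm X_i;\bm v_\gamma,\bm p_\gamma))$ for all $i\in[n]$; (ii) $\Pr_{(\bm X,y)\sim\mathcal D}\big(y\ne\operatorname{sign}(f(\bm X;\bm v_\gamma,\bm p_\gamma))\big)\le\eta+\exp(-a_1d/n^2)+\exp\big(-a_2(1/\rho^2+\eta n/d)^{-1}\big)$.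
   Context: Data. $\bm\mu_1,\bm\mu_2\in\mathbb R^d$ are fixed orthogonal vectors with $\|\bm\mu_1\|=\|\bm\mu_2\|=\rho>0$. A sample $(\bm X,\tilde y)\sim\mathcal D_{\rm clean}$ is generated as follows: $\tilde y$ is uniform on $\{\pm1\}$; the signal is $\bm u=\bm\mu_1$ if $\tilde y=1$ and $\bm u=\bm\mu_2$ if $\tilde y=-1$; $\bm\xi_2,\dots,\bm\xi_T$ are i.i.d. $N(\bm 0,\bm I_d-\bm\mu_1\bm\mu_1^\top/\rho^2-\bm\mu_2\bm\mu_2^\top/\rho^2)$; the rows (tokens) of $\bm X\in\mathbb R^{T\times d}$ are $\bm u,\bm\xi_2,\dots,\bm\xi_T$, with $\bm u$ placed at a uniformly random position (the model below does not depend on the order of tokens). $(\bm X,y)\sim\mathcal D$ is obtained from $(\bm X,\tilde y)\sim\mathcal D_{\rm clean}$ by setting $y=\tilde y$ with probability $1-\eta$ and $y=-\tilde y$ with probability $\eta$, $\eta\in[0,1/2)$. The training set is $(\bm X_i,y_i)_{i=1}^n$ i.i.d. from $\mathcal D$. Model. $f(\bm X;\bm v,\bm p)=\bm v^\top\bm X^\top\mathbb S(\bm X\bm p)$ with $\bm v,\bm p\in\mathbb R^d$ and $\mathbb S$ the softmax on $\mathbb R^T$. *)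

(* Defs.v *)
From HB Require Import structures.
From mathcomp Require Import all_boot all_order all_algebra.
From mathcomp Require Import all_classical all_reals all_analysis.
From mathcomp Require Import measurable_realfun measurable_fun_approximation.

Set Implicit Arguments.
Unset Strict Implicit.
Unset Printing Implicit Defensive.

Import Order.TTheory GRing.Theory Num.Theory.
Import numFieldNormedType.Exports.

Local Open Scope classical_set_scope.
Local Open Scope ring_scope.

HB.instance Definition _ (n : nat) := isPointed.Build 'I_n.+1 ord0.

HB.instance Definition _ (n : nat) :=
  @isMeasurable.Build default_measure_display 'I_n.+1
    (@discrete_measurable 'I_n.+1) (@discrete_measurable0 _)
    (@discrete_measurableC _) (@discrete_measurableU _).

(* sigma-algebra generated by the entries; it is the Borel sigma-algebra *)
Section matrix_measurable.
Context (R : realType) (m n : nat).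

Definition mx_entry_sets : set (set 'M[R]_(m, n)) :=
  \bigcup_(ij in [set: 'I_m * 'I_n])
    preimage_set_system setT (fun A : 'M[R]_(m, n) => A ij.1 ij.2) measurable.

HB.instance Definition _ := @isMeasurable.Build (sigma_display mx_entry_sets)
  'M[R]_(m, n) <<s mx_entry_sets >> (@sigma_algebra0 _ setT mx_entry_sets)
  (@sigma_algebraC _ mx_entry_sets) (@sigma_algebra_bigcup _ setT mx_entry_sets).

Lemma measurable_entry i j :
  measurable_fun [set: 'M[R]_(m, n)] (fun A : 'M[R]_(m, n) => A i j).
Proof.
move=> _ Y mY; apply: sub_sigma_algebra; exists (i, j) => //=.
by exists Y.
Qed.

Lemma measurable_fun_mxP d (T : measurableType d) (f : T -> 'M[R]_(m, n)) :
  measurable_fun [set: T] f <->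
  forall i j, measurable_fun [set: T] (fun x => f x i j).
Proof.
split=> [mf i j|mf].
  exact: (@measurableT_comp _ _ _ _ _ _
    (fun A : 'M[R]_(m, n) => A i j) _ f (measurable_entry i j) mf).
apply: (@measurability _ _ _ _ _ _ mx_entry_sets) => //.
move=> _ [_ [[i j] _ [B mB <-]] <-] /=.
have := mf i j measurableT B mB.
by rewrite !setTI.
Qed.

End matrix_measurable.

Section product_of_laws.
Context (R : realType).

Section prod.
Context d1 d2 (T1 : measurableType d1) (T2 : measurableType d2).

Definition prod_prob (P : probability T1 R) (Q : probability T2 R) :
  set (T1 * T2) -> \bar R := (P \x Q)%E.

Context (P : probability T1 R) (Q : probability T2 R).

HB.instance Definition _ := Measure.on (prod_prob P Q).

Let prod_prob_setT : prod_prob P Q setT = 1%E.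
Proof.
rewrite /prod_prob -setXTT.
rewrite [LHS]product_measure1E//.
by rewrite -[RHS]mule1; congr (_ * _)%E; exact: probability_setT.
Qed.

HB.instance Definition _ :=
  Measure_isProbability.Build _ _ _ (prod_prob P Q) prod_prob_setT.

End prod.

Section iid.
Context d (T : measurableType d).

Definition tuple_cons n (x : T * n.-tuple T) : n.+1.-tuple T :=
  [tuple of x.1 :: x.2].

Lemma measurable_tuple_cons n : measurable_fun setT (@tuple_cons n).
Proof. exact: measurable_cons. Qed.

HB.instance Definition _ n :=
  isMeasurableFun.Build _ _ _ _ (@tuple_cons n) (@measurable_tuple_cons n).

(* law of n independent draws from P *)
Fixpoint iid_prob (P : probability T R) n : probability (n.-tuple T) R :=
  if n is n'.+1 then distribution (prod_prob P (iid_prob P n')) (@tuple_cons n')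
  else dirac [tuple].

Lemma iid_probE (P : probability T R) n (A : 'I_n -> set T) :
  (forall i, measurable (A i)) ->
  iid_prob P n [set t | forall i, A i (tnth t i)] = (\prod_(i < n) P (A i))%E.
Proof.
elim: n A => [|n IHn] A mA.
  rewrite big_ord0 /= diracE mem_set//= => i; by case: i.
rewrite big_ord_recl -IHn; last by move=> i; exact: mA.
rewrite /= /distribution /pushforward.
have mB : measurable [set t : n.-tuple T |
    forall i, A (lift ord0 i) (tnth t i)].
  rewrite (_ : mkset _ = \bigcap_(i in [set: 'I_n])
      ((fun t : n.-tuple T => tnth t i) @^-1` A (lift ord0 i))); last first.
    by apply/seteqP; split=> t /= h i; [move=> _|]; exact: h.
  apply: fin_bigcap_measurable => //= i _.
  rewrite -[X in measurable X]setTI.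
  exact: measurable_tnth.
rewrite -[RHS]product_measure1E//.
congr (prod_prob P _ _); apply/seteqP; split=> -[x t] /= h.
  split; first exact: (h ord0).
  by move=> i; have := h (lift ord0 i); rewrite tnthS.
move=> i; case: (unliftP ord0 i) => [j|] ->; last exact: h.1.
by rewrite tnthS; exact: h.2.
Qed.

End iid.

(* uniform law on the n.+1 indices; the second argument of mnormalize is used
   only for a measure of total mass 0 or +oo *)
Definition uniform_ord n : probability 'I_n.+1 R :=
  mnormalize counting (\d_ (ord0 : 'I_n.+1)).

Lemma uniform_ordE n (i : 'I_n.+1) :
  uniform_ord n [set i] = (n.+1%:R^-1)%:E.
Proof.
have cT : @counting _ R [set: 'I_n.+1] = (n.+1%:R : R)%:E.
  rewrite /counting asboolT; last exact: finite_finset.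
  congr (_%:R%:E); apply: card_fset_set.
  by rewrite card_eq_sym; exact: card_II.
have c1 : @counting _ R [set i] = (1 : R)%:E.
  by rewrite /counting asboolT// fset_set1 finmap.cardfs1.
have mnormE (mu : {measure set 'I_n.+1 -> \bar R}) (P : probability 'I_n.+1 R) :
    mu setT = (n.+1%:R : R)%:E -> mu [set i] = (1 : R)%:E ->
    mnormalize mu P [set i] = (n.+1%:R^-1)%:E.
  move=> muT mu1; rewrite /mnormalize; case: ifPn => [|_].
    by rewrite muT; move=> /orP[|] /eqP// [] /eqP; rewrite pnatr_eq0.
  by rewrite mu1 muT mul1e.
exact: mnormE.
Qed.

End product_of_laws.

Section model.
Context (R : realType).

(* the library norm `|x| of a matrix is the sup norm *)
Definition l2norm n (x : 'cV[R]_n) : R := Num.sqrt (\sum_(i < n) x i 0 ^+ 2).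

Definition dotp n (x y : 'cV[R]_n) : R := (x^T *m y) 0 0.

Definition softmax n (s : 'cV[R]_n) : 'cV[R]_n :=
  \col_i (expR (s i 0) / \sum_j expR (s j 0)).

Definition attn T d (X : 'M[R]_(T, d)) (v p : 'cV[R]_d) : R :=
  (v^T *m X^T *m softmax (X *m p)) 0 0.

End model.

Section data.
Context (R : realType) (d : nat).

Section gaussian.

(* normal_prob is a measure on measurableTypeR R, a copy of R *)
Definition linear_image (A : 'M[R]_d) (z : d.-tuple (measurableTypeR R)) :
    'cV[R]_d :=
  A *m \col_i tnth z i.

Lemma measurable_linear_image A : measurable_fun setT (linear_image A).
Proof.
apply/measurable_fun_mxP => i j.
under eq_fun do rewrite mxE.
apply: measurable_sum => k; apply: measurable_funM => //.
under eq_fun do rewrite mxE.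
exact: measurable_tnth.
Qed.

HB.instance Definition _ A :=
  isMeasurableFun.Build _ _ _ _ (linear_image A) (measurable_linear_image A).

(* N(0, A *m A^T), as the law of A *m z for z a standard Gaussian vector *)
Definition gaussian (A : 'M[R]_d) : probability 'cV[R]_d R :=
  distribution (iid_prob (normal_prob (0 : R) 1) d) (linear_image A).

(* an orthogonal projection, hence its own square root: noise_cov_sqrt *)
Definition noise_cov (rho : R) (mu1 mu2 : 'cV[R]_d) : 'M[R]_d :=
  1%:M - rho ^- 2 *: (mu1 *m mu1^T) - rho ^- 2 *: (mu2 *m mu2^T).

Lemma noise_cov_sqrt rho mu1 mu2 :
  0 < rho -> dotp mu1 mu2 = 0 -> l2norm mu1 = rho -> l2norm mu2 = rho ->
  noise_cov rho mu1 mu2 *m (noise_cov rho mu1 mu2)^T = noise_cov rho mu1 mu2.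
Proof.
move=> rho0 mu12 mu1rho mu2rho.
have dotpE (x y : 'cV[R]_d) : x^T *m y = (dotp x y)%:M.
  by rewrite /dotp [LHS]mx11_scalar.
have sqE (x : 'cV[R]_d) : l2norm x = rho -> x^T *m x = (rho ^+ 2)%:M.
  move=> <-; rewrite dotpE; congr (_%:M).
  rewrite sqr_sqrtr; last by apply: sumr_ge0 => i _; exact: sqr_ge0.
  by rewrite /dotp mxE; apply: eq_bigr => i _; rewrite mxE expr2.
have mu12' : mu1^T *m mu2 = 0 by rewrite dotpE mu12 raddf0.
have mu21' : mu2^T *m mu1 = 0 by rewrite -[LHS]trmxK trmx_mul trmxK mu12' trmx0.
have r0 : rho ^+ 2 != 0 by rewrite expf_neq0// gt_eqF.
set P1 := rho ^- 2 *: (mu1 *m mu1^T); set P2 := rho ^- 2 *: (mu2 *m mu2^T).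
have idem (x : 'cV[R]_d) : l2norm x = rho ->
    (rho ^- 2 *: (x *m x^T)) *m (rho ^- 2 *: (x *m x^T))
    = rho ^- 2 *: (x *m x^T).
  move=> xr; rewrite -scalemxAl -scalemxAr mulmxA -(mulmxA x) sqE//.
  by rewrite mul_mx_scalar -scalemxAl scalerA mulVf// scale1r.
have P12 : P1 *m P2 = 0.
  rewrite /P1 /P2 -scalemxAl -scalemxAr mulmxA -(mulmxA mu1) mu12'.
  by rewrite mulmx0 mul0mx !scaler0.
have P21 : P2 *m P1 = 0.
  rewrite /P1 /P2 -scalemxAl -scalemxAr mulmxA -(mulmxA mu2) mu21'.
  by rewrite mulmx0 mul0mx !scaler0.
have -> : (noise_cov rho mu1 mu2)^T = noise_cov rho mu1 mu2.
  rewrite /noise_cov !linearB/= tr_scalar_mx !linearZ/=.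
  by rewrite !trmx_mul !trmxK.
rewrite /noise_cov -/P1 -/P2 !mulmxBr !mulmxBl !mulmx1 !mul1mx P12 P21.
rewrite (idem mu1)// (idem mu2)// -/P1 -/P2.
by rewrite (subr0 P2) (subrr P1) (subrr P2) !subr0.
Qed.

End gaussian.

(* an input has m.+1 tokens: one signal token and m noise tokens *)
Context (m : nat).

Definition pm1 (b : bool) : R := if b then 1 else -1.

Definition clean_tokens (u : 'cV[R]_d) (pos : 'I_m.+1)
    (xi : m.-tuple 'cV[R]_d) : 'M[R]_(m.+1, d) :=
  \matrix_(t, k) (if unlift pos t is Some s then tnth xi s else u) k 0.

(* w.1.1 = true encodes label +1 *)
Definition clean_sample (mu1 mu2 : 'cV[R]_d)
    (w : (bool * 'I_m.+1) * m.-tuple 'cV[R]_d) : 'M[R]_(m.+1, d) * R :=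
  (clean_tokens (if w.1.1 then mu1 else mu2) w.1.2 w.2, pm1 w.1.1).

Lemma measurable_clean_sample mu1 mu2 :
  measurable_fun setT (clean_sample mu1 mu2).
Proof.
have mdisc d' (T : measurableType d') (g : bool * 'I_m.+1 -> T) :
    measurable_fun setT g.
  move=> _ Y mY; rewrite setTI.
  rewrite (_ : g @^-1` Y = \bigcup_(x in g @^-1` Y) ([set x.1] `*` [set x.2])).
    apply: fin_bigcup_measurable; first exact: finite_finset.
    by move=> x _; exact: measurableX.
  apply/seteqP; split=> [x Yx|x [y Yy /= [x1 x2]]]; first by exists x.
  by rewrite (_ : x = y) // (surjective_pairing x) x1 x2 -surjective_pairing.
apply/measurable_fun_pairP; split; last first.
  exact: (measurableT_comp (mdisc _ _ (fun x => pm1 x.1)) measurable_fst).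
apply/measurable_fun_mxP => t k.
rewrite (_ : (fun _ => _) = fun w : (bool * 'I_m.+1) * m.-tuple 'cV[R]_d =>
    \sum_(j < m.+1) (w.1.2 == j)%:R *
      (if unlift j t is Some s then tnth w.2 s
       else if w.1.1 then mu1 else mu2) k 0); last first.
  apply/funext => w /=; rewrite mxE (bigD1 w.1.2)//= eqxx mul1r.
  by rewrite big1 ?addr0// => j /negPf; rewrite eq_sym => ->; rewrite mul0r.
apply: measurable_sum => j; apply: measurable_funM.
  exact: (measurableT_comp (mdisc _ _ (fun x => (x.2 == j)%:R : R))
    measurable_fst).
case: unlift => [s|].
  apply: (measurableT_comp (measurable_entry k 0)).
  exact: (measurableT_comp (measurable_tnth s) measurable_snd).
exact: (measurableT_comp (mdisc _ _
  (fun x => (if x.1 then mu1 else mu2) k 0)) measurable_fst).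
Qed.

HB.instance Definition _ mu1 mu2 := isMeasurableFun.Build _ _ _ _
  (clean_sample mu1 mu2) (measurable_clean_sample mu1 mu2).

(* gaussian (noise_cov _ _ _) is N(0, noise_cov _ _ _) by noise_cov_sqrt *)
Definition D_clean (rho : R) (mu1 mu2 : 'cV[R]_d) :
    probability ('M[R]_(m.+1, d) * R)%type R :=
  distribution
    (prod_prob (prod_prob (bernoulli_prob (2^-1 : R)) (uniform_ord R m))
               (iid_prob (gaussian (noise_cov rho mu1 mu2)) m))
    (clean_sample mu1 mu2).

Definition flip_label (w : ('M[R]_(m.+1, d) * R) * bool) :
    'M[R]_(m.+1, d) * R :=
  (w.1.1, if w.2 then - w.1.2 else w.1.2).

Lemma measurable_flip_label : measurable_fun setT flip_label.
Proof.
have m1 : measurable_fun setT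
    (fun w : ('M[R]_(m.+1, d) * R) * bool => w.1) by exact: measurable_fst.
apply/measurable_fun_pairP; split => /=.
  exact: (measurableT_comp measurable_fst m1).
have m2 : measurable_fun setT (fun w : ('M[R]_(m.+1, d) * R) * bool => w.1.2).
  exact: (measurableT_comp measurable_snd m1).
rewrite /comp /=.
apply: measurable_fun_ifT => //.
exact: (measurableT_comp (@oppr_measurable R setT) m2).
Qed.

HB.instance Definition _ :=
  isMeasurableFun.Build _ _ _ _ flip_label measurable_flip_label.

Definition D_noisy (rho : R) (mu1 mu2 : 'cV[R]_d) (eta : R) :
    probability ('M[R]_(m.+1, d) * R)%type R :=
  distribution (prod_prob (D_clean rho mu1 mu2) (bernoulli_prob eta)) flip_label.

End data.

Section training.
Context (R : realType) (T d n : nat).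
Implicit Types (S : n.-tuple ('M[R]_(T, d) * R)) (v p : 'cV[R]_d).

Definition feasible S (gamma : R) v p : Prop :=
  forall i : 'I_n, gamma <= (tnth S i).2 * attn (tnth S i).1 v p.

Definition is_solution S (gamma : R) v p : Prop :=
  feasible S gamma v p /\
  forall v' p', feasible S gamma v' p' ->
    l2norm p ^+ 2 + l2norm v ^+ 2 <= l2norm p' ^+ 2 + l2norm v' ^+ 2.

End training.

(* inner probability: A is not required to be measurable *)
Definition with_prob_ge (R : realType) d (T : measurableType d)
    (P : probability T R) (q : R) (A : T -> Prop) : Prop :=
  exists E : set T, [/\ measurable E, E `<=` [set x | A x] & (q%:E <= P E)%E].

(* Main.v *)
Require Import Defs.
From HB Require Import structures.
From mathcomp Require Import all_boot all_order all_algebra.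
From mathcomp Require Import all_classical all_reals all_analysis.
From mathcomp Require Import measurable_realfun measurable_fun_approximation.
From mathcomp Require Import ring lra.

Set Implicit Arguments.
Unset Strict Implicit.
Unset Printing Implicit Defensive.

Import Order.TTheory GRing.Theory Num.Theory.
Import numFieldNormedType.Exports.

Local Open Scope classical_set_scope.
Local Open Scope ring_scope.

(* For large gamma the softmax saturates, so the problem behaves like a hard
   token selection. Whatever the attention weights are, a sample has margin
   gamma only if one of its tokens has value [y * <v, x> >= gamma]. With high
   probability the noise tokens are almost orthogonal with squared norm of
   order d, so giving the value gamma to N of them costs about
   [N * gamma^2 / d], whereas a signal token costs [gamma^2 / rho^2]. As few
   samples are noisy, a minimizer cannot afford to memorize a whole class of
   clean samples; hence [<v, mu1> >= gamma] and [<v, mu2> <= - gamma], and each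
   noisy sample has a noise token of value at least gamma.

   Compare (v, p) with the pair obtained by lowering the signal components of
   v to gamma and replacing p by [L * q], where [L = 2 ln gamma] and q
   separates the tokens of value gamma. Optimality bounds the excess of the
   signal components over gamma and gives [|p|^2 = O(L^2 |q|^2)]. A small
   excess forces most clean samples to put almost all their attention on the
   signal, with a score gap of at least [L / 2]; achieving this on the noise
   side would make p too long, so [<mu_k, p> >= L / 4]. On a fresh sample
   [<v, xi>] and [<p, xi>] are Gaussian with standard deviations much smaller
   than gamma and L, and the error is at most [eta + exp (- d / n^2)]. *)

(** * Dot products *)

(** The problem is not convex and its solutions need not be unique, so every property of (v, p) is
    obtained by comparing its cost with that of an explicit feasible pair. Costs are measured in
    units of [A = theta * n / d]. A Bessel inequality for the noise tokens shows that giving value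
    gamma to a noise token in each of [n / 8] clean samples needs [|v|^2 >= n * gamma^2 / (40 * d)],
    which a small constant theta rules out; the same inequality, applied to p, rules out large
    negative scores.

    The choice [L = 2 ln gamma] meets two demands. The softmax mass off the focused token is of
    order [exp (- L) = gamma^-2], so the factor [1 + t] on v that compensates for it changes [|v|^2]
    by [O(t * gamma^2 * A)], an amount free of gamma that is absorbed by [L^2 * A]. Conversely, if
    the signal exceeds gamma by at most 1/2 and the noise values are at most gamma / 2, the
    attention ratio of noise to signal is at most [1 / gamma = exp (- L / 2)], which is the score
    gap of [L / 2]. *)

Section dot_product.
Context (R : realType) (d : nat).
Implicit Types (x y z : 'cV[R]_d) (a : R).

Lemma dotpE x y : dotp x y = \sum_i x i 0 * y i 0.
Proof. by rewrite /dotp mxE; apply: eq_bigr => i _; rewrite mxE. Qed.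

Lemma dotpC x y : dotp x y = dotp y x.
Proof. by rewrite !dotpE; apply: eq_bigr => i _; rewrite mulrC. Qed.

Lemma dotpDr x y z : dotp x (y + z) = dotp x y + dotp x z.
Proof. by rewrite /dotp mulmxDr mxE. Qed.

Lemma dotpZr a x y : dotp x (a *: y) = a * dotp x y.
Proof. by rewrite /dotp -scalemxAr mxE. Qed.

Lemma dotpDl x y z : dotp (y + z) x = dotp y x + dotp z x.
Proof. by rewrite !(dotpC _ x) dotpDr. Qed.

Lemma dotpZl a x y : dotp (a *: y) x = a * dotp y x.
Proof. by rewrite !(dotpC _ x) dotpZr. Qed.

Lemma dotpNr x y : dotp x (- y) = - dotp x y.
Proof. by rewrite -scaleN1r dotpZr mulN1r. Qed.

Lemma dotpNl x y : dotp (- y) x = - dotp y x.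
Proof. by rewrite !(dotpC _ x) dotpNr. Qed.

Lemma dotp0r x : dotp x 0 = 0.
Proof. by rewrite -(scale0r 0) dotpZr mul0r. Qed.

Lemma dotp0l x : dotp 0 x = 0.
Proof. by rewrite dotpC dotp0r. Qed.

Lemma dotp_sumr (I : finType) (Q : pred I) (F : I -> 'cV[R]_d) x :
  dotp x (\sum_(i | Q i) F i) = \sum_(i | Q i) dotp x (F i).
Proof.
by elim/big_rec2 : _ => [|i y z _ <-]; rewrite ?dotp0r ?dotpDr.
Qed.

Lemma dotp_suml (I : finType) (Q : pred I) (F : I -> 'cV[R]_d) x :
  dotp (\sum_(i | Q i) F i) x = \sum_(i | Q i) dotp (F i) x.
Proof. by rewrite dotpC dotp_sumr; apply: eq_bigr => i _; rewrite dotpC. Qed.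

Definition dotpLin := (dotpDl, dotpDr, dotpNl, dotpNr, dotpZl, dotpZr).

Lemma dotp_ge0 x : 0 <= dotp x x.
Proof. by rewrite dotpE; apply: sumr_ge0 => i _; rewrite -expr2 sqr_ge0. Qed.

Lemma l2norm_sqr x : l2norm x ^+ 2 = dotp x x.
Proof.
rewrite sqr_sqrtr; last by apply: sumr_ge0 => i _; exact: sqr_ge0.
by rewrite dotpE; apply: eq_bigr => i _; rewrite expr2.
Qed.

Lemma dotp_eq0 x : dotp x x = 0 -> x = 0.
Proof.
move=> /eqP; rewrite dotpE psumr_eq0 => [/allP h|i _]; last by rewrite -expr2 sqr_ge0.
apply/matrixP => i j; rewrite ord1 mxE.
by have := h i (mem_index_enum _); rewrite -expr2 sqrf_eq0 => /eqP.
Qed.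

Lemma cauchy_schwarz x y : dotp x y ^+ 2 <= dotp x x * dotp y y.
Proof.
have [y0|y0] := eqVneq (dotp y y) 0.
  by rewrite (dotp_eq0 y0) !dotp0r expr0n mulr0.
have yp : 0 < dotp y y by rewrite lt_def y0 dotp_ge0.
have := dotp_ge0 (dotp y y *: x - dotp x y *: y).
rewrite !dotpLin (dotpC y x) => h.
have {}h : 0 <= dotp y y * (dotp x x * dotp y y - dotp x y ^+ 2).
  by apply: le_trans h _; rewrite le_eqVlt; apply/orP; left; apply/eqP; ring.
by rewrite -subr_ge0 -(pmulr_rge0 _ yp).
Qed.

Lemma dotp_mulmxr (A : 'M[R]_d) x y : dotp x (A *m y) = dotp (A^T *m x) y.
Proof. by rewrite /dotp trmx_mul trmxK mulmxA. Qed.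

(** Gershgorin's bound for the Gram matrix of [w]: [|a i * a j| <= (a i ^+ 2 + a j ^+ 2) / 2] off
    the diagonal, and each square is then counted [#|I|] times with weight [t]. *)
Lemma almost_orthogonal_norm (I : finType) (w : I -> 'cV[R]_d) (a : I -> R) (D t : R) :
  0 <= t -> (forall i, dotp (w i) (w i) <= D) ->
  (forall i j, i != j -> `|dotp (w i) (w j)| <= t) ->
  dotp (\sum_i a i *: w i) (\sum_i a i *: w i)
    <= (D + #|I|%:R * t) * \sum_i a i ^+ 2.
Proof.
move=> t0 hD ht.
apply: (@le_trans _ _ (\sum_i (D * a i ^+ 2 +
    \sum_j t * ((a i ^+ 2 + a j ^+ 2) / 2)))).
  rewrite dotp_suml; apply: ler_sum => i _.
  rewrite dotp_sumr (bigD1 i)//= dotpLin dotpZr.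
  apply: lerD.
    by have := hD i; have := sqr_ge0 (a i); nra.
  rewrite [leRHS](bigD1 i)//= -[leLHS]add0r; apply: lerD.
    by rewrite mulr_ge0// divr_ge0// addr_ge0// sqr_ge0.
  apply: ler_sum => j ji; rewrite dotpLin dotpZr mulrA.
  apply: le_trans (ler_norm _) _; rewrite normrM mulrC.
  apply: ler_pM => //; first by rewrite ht// eq_sym.
  have := sqr_ge0 (`|a i| - `|a j|); rewrite normrM -(real_normK (num_real (a i))).
  by rewrite -(real_normK (num_real (a j))); nra.
rewrite big_split/= -mulr_sumr mulrDl lerD2l.
have sumc (F : I -> R) : \sum_i \sum_(j : I) F i = #|I|%:R * \sum_i F i.
  by rewrite mulr_sumr; apply: eq_bigr => i _; rewrite sumr_const mulr_natl.
have -> : \sum_i \sum_j t * ((a i ^+ 2 + a j ^+ 2) / 2) =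
    t / 2 * (\sum_i \sum_(j : I) a i ^+ 2 + \sum_(i : I) \sum_j a j ^+ 2).
  rewrite -big_split mulr_sumr; apply: eq_bigr => i _ /=.
  by rewrite -big_split mulr_sumr; apply: eq_bigr => j _ /=; field.
have -> : \sum_(i : I) \sum_j a j ^+ 2 = #|I|%:R * \sum_j a j ^+ 2.
  by rewrite exchange_big sumc.
rewrite sumc.
by rewrite le_eqVlt; apply/orP; left; apply/eqP; field.
Qed.

(** Dual to [almost_orthogonal_norm]: with [u] the sum of the [dotp v (w i) *: w i], the left-hand
    side is [dotp v u], and Cauchy-Schwarz applies since [dotp u u] is bounded by a multiple of the
    same sum. *)
Lemma almost_orthogonal_bessel (I : finType) (w : I -> 'cV[R]_d) (v : 'cV[R]_d) (D t : R) :
  0 <= D -> 0 <= t -> (forall i, dotp (w i) (w i) <= D) ->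
  (forall i j, i != j -> `|dotp (w i) (w j)| <= t) ->
  \sum_i dotp v (w i) ^+ 2 <= (D + #|I|%:R * t) * dotp v v.
Proof.
move=> D0 t0 hD ht.
set S := \sum_i _.
have S0 : 0 <= S by apply: sumr_ge0 => i _; exact: sqr_ge0.
have h := almost_orthogonal_norm (fun i => dotp v (w i)) t0 hD ht.
set u := \sum_i _ *: _ in h.
have uS : dotp v u = S.
  by rewrite dotp_sumr; apply: eq_bigr => i _; rewrite dotpZr expr2.
have := cauchy_schwarz v u; rewrite uS -/S => cs.
have [->|Sn] := eqVneq S 0.
  by rewrite mulr_ge0 ?dotp_ge0// addr_ge0 ?mulr_ge0.
have Sp : 0 < S by rewrite lt_def Sn.
rewrite -(ler_pM2l Sp) -expr2 (le_trans cs)//.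
by rewrite mulrC mulrA (mulrC S) ler_wpM2r ?dotp_ge0.
Qed.

End dot_product.

(** * The projection onto the orthogonal complement of the signals *)

Section noise_projection.
Context (R : realType) (d : nat) (rho : R) (mu1 mu2 : 'cV[R]_d).
Local Notation P := (noise_cov rho mu1 mu2).
Implicit Types x y : 'cV[R]_d.

Lemma mulmx_rank1 x y z : x *m y^T *m z = dotp y z *: x :> 'cV[R]_d.
Proof. by rewrite -mulmxA [y^T *m z]mx11_scalar mul_mx_scalar. Qed.

Lemma noise_covE x :
  P *m x = x - rho ^- 2 *: (dotp mu1 x *: mu1) - rho ^- 2 *: (dotp mu2 x *: mu2).
Proof. by rewrite /noise_cov !mulmxBl mul1mx -!scalemxAl !mulmx_rank1. Qed.

Lemma noise_cov_tr : P^T = P.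
Proof.
by rewrite /noise_cov !linearB/= tr_scalar_mx !linearZ/= !trmx_mul !trmxK.
Qed.

Lemma noise_cov_id x : dotp mu1 x = 0 -> dotp mu2 x = 0 -> P *m x = x.
Proof. by move=> h1 h2; rewrite noise_covE h1 h2 !scale0r !scaler0 !subr0. Qed.

Hypotheses (rho0 : 0 < rho) (mu12 : dotp mu1 mu2 = 0)
  (mu1rho : l2norm mu1 = rho) (mu2rho : l2norm mu2 = rho).

Lemma dotp_mu1 : dotp mu1 mu1 = rho ^+ 2. Proof. by rewrite -l2norm_sqr mu1rho. Qed.

Lemma dotp_mu2 : dotp mu2 mu2 = rho ^+ 2. Proof. by rewrite -l2norm_sqr mu2rho. Qed.

Lemma noise_cov_mu1 : P *m mu1 = 0.
Proof.
rewrite noise_covE dotp_mu1 (dotpC mu2) mu12 scale0r scaler0 subr0 scalerA.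
by rewrite mulVf ?expf_neq0 ?gt_eqF// scale1r subrr.
Qed.

Lemma noise_cov_mu2 : P *m mu2 = 0.
Proof.
rewrite noise_covE dotp_mu2 mu12 scale0r scaler0 subr0 scalerA.
by rewrite mulVf ?expf_neq0 ?gt_eqF// scale1r subrr.
Qed.

Lemma dotp_mu1_noise x : dotp mu1 (P *m x) = 0.
Proof. by rewrite dotp_mulmxr noise_cov_tr noise_cov_mu1 dotp0l. Qed.

Lemma dotp_mu2_noise x : dotp mu2 (P *m x) = 0.
Proof. by rewrite dotp_mulmxr noise_cov_tr noise_cov_mu2 dotp0l. Qed.

Lemma dotp_noise_cov x :
  dotp (P *m x) (P *m x) =
    dotp x x - (dotp mu1 x / rho) ^+ 2 - (dotp mu2 x / rho) ^+ 2.
Proof.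
rewrite dotp_mulmxr noise_cov_tr noise_cov_id ?dotp_mu1_noise ?dotp_mu2_noise//.
rewrite noise_covE !dotpLin !(dotpC _ x) !(dotpC x) -!exprVn.
by ring.
Qed.

Lemma dotp_noise_cov_le x : dotp (P *m x) (P *m x) <= dotp x x.
Proof. by rewrite dotp_noise_cov -addrA gerDl -opprD oppr_le0 addr_ge0 ?sqr_ge0. Qed.

End noise_projection.

(** * Independent samples *)

Lemma measurable_ge_fun (R : realType) d (T : measurableType d) (f : T -> R) s :
  measurable_fun setT f -> measurable [set x | s <= f x].
Proof.
by move=> mf; rewrite -[X in measurable X]setTI; exact: measurable_fun_le.
Qed.

Lemma measurable_preimage d d' (T : measurableType d) (T' : measurableType d')
    (f : T -> T') (A : set T') :
  measurable_fun setT f -> measurable A -> measurable [set x | A (f x)].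
Proof. by move=> mf mA; rewrite -[X in measurable X]setTI; exact: mf. Qed.

Section prod_bounds.
Context (R : realType) d1 d2 (T1 : measurableType d1) (T2 : measurableType d2).
Context (P : probability T1 R) (Q : probability T2 R).
Implicit Types A : set (T1 * T2).

Lemma xsection_mkset A x : xsection A x = [set y | A (x, y)].
Proof. by apply/seteqP; split => t /=; rewrite /xsection/= inE. Qed.

Lemma measurable_section A x :
  measurable A -> measurable [set y | A (x, y)].
Proof. by move=> /(measurable_xsection x); rewrite xsection_mkset. Qed.

Lemma measurable_fun_section A :
  measurable A -> measurable_fun [set: T1] (Q \o (fun x => [set y | A (x, y)])).
Proof.
move=> mA; have := measurable_fun_xsection Q mA.
by congr measurable_fun; apply/funext => x /=; rewrite xsection_mkset.
Qed.

Lemma prod_probE A :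
  prod_prob P Q A = (\int[P]_x Q [set y | A (x, y)])%E.
Proof.
rewrite /prod_prob /product_measure1.
by apply: eq_integral => x _ /=; rewrite xsection_mkset.
Qed.

Lemma prod_prob_le A (B : set T1) (q r : R) : measurable A -> measurable B ->
  0 <= q -> (P B <= r%:E)%E ->
  (forall x, ~ B x -> (Q [set y | A (x, y)] <= q%:E)%E) ->
  (prod_prob P Q A <= (r + q)%:E)%E.
Proof.
move=> mA mB q0 PB hQ; rewrite prod_probE.
apply: (@le_trans _ _ (\int[P]_x ((\1_B x)%:E + cst q%:E x))%E).
  apply: ge0_le_integral => //.
  - exact: measurable_fun_section.
  - apply: emeasurable_funD => //; apply/measurable_EFinP.
    exact: measurable_indic.
  - move=> x _; rewrite indicE; have [/set_mem Bx|/negP Bx] := boolP (x \in B).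
      apply: (@le_trans _ _ 1%E).
        exact/probability_le1/measurable_section.
      by rewrite -EFinD lee_fin lerDl.
    by rewrite add0e; apply: hQ => /mem_set.
rewrite ge0_integralD//; last by apply/measurable_EFinP; exact: measurable_indic.
rewrite (integral_cst P measurableT q%:E) (integral_indic P measurableT mB) setIT EFinD.
apply: leeD => //; have := probability_setT P.
by rewrite /= => ->; rewrite mule1.
Qed.

Lemma prod_prob_le_sup A (q : R) : measurable A -> 0 <= q ->
  (forall x, (Q [set y | A (x, y)] <= q%:E)%E) ->
  (prod_prob P Q A <= q%:E)%E.
Proof.
move=> mA q0 hQ; rewrite -[q]add0r; apply: (@prod_prob_le _ set0) => //.
by rewrite measure0.
Qed.

End prod_bounds.

Section union_bounds.
Context (R : realType) d (T : measurableType d) (P : probability T R).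
Implicit Types A B : set T.

Lemma prob_le A B (q : R) : measurable A -> measurable B -> A `<=` B ->
  (P B <= q%:E)%E -> (P A <= q%:E)%E.
Proof. by move=> mA mB AB; apply: le_trans; apply: le_measure; rewrite ?inE. Qed.

Lemma prob_setU_le A B (q r : R) : measurable A -> measurable B ->
  (P A <= q%:E)%E -> (P B <= r%:E)%E -> (P (A `|` B) <= (q + r)%:E)%E.
Proof.
by move=> mA mB Aq Br; rewrite EFinD (le_trans (measureU2 _ mA mB)) ?leeD.
Qed.

Lemma measurable_exists (I : finType) (D : pred I) (A : I -> set T) :
  (forall i, measurable (A i)) -> measurable [set t | exists2 i, D i & A i t].
Proof.
move=> mA; rewrite (_ : mkset _ = \bigcup_(i in [set i | D i]) A i) //.
by apply: fin_bigcup_measurable => //; exact: finite_finset.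
Qed.

Lemma prob_exists_le (I : finType) (D : pred I) (A : I -> set T) (q : R) :
  0 <= q -> (forall i, measurable (A i)) ->
  (forall i, D i -> (P (A i) <= q%:E)%E) ->
  (P [set t | exists2 i, D i & A i t] <= (#|D|%:R * q)%:E)%E.
Proof.
move=> q0 mA hA.
have key (s : seq I) : measurable (\big[setU/set0]_(i <- s | D i) A i) /\
    (P (\big[setU/set0]_(i <- s | D i) A i) <= ((count D s)%:R * q)%:E)%E.
  elim: s => [|i s [ms hs]]; first by rewrite big_nil measure0 mul0r.
  rewrite big_cons /=; case: ifP => [Di|_]; last by rewrite add0n.
  split; first exact: measurableU.
  rewrite natrD mulrDl mul1r; apply: prob_setU_le => //.
  exact: hA.
have cD : count D (enum I) = #|D|.
  by rewrite -sum1_count big_enum_cond -sum1_card; apply: eq_bigl => i.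
rewrite -cD (_ : [set t | _] = \big[setU/set0]_(i <- enum I | D i) A i).
  exact: (key _).2.
rewrite -bigcup_seq_cond; apply/seteqP; split => t /=.
  by move=> [i Di Ait]; exists i => //=; rewrite mem_enum.
by move=> [i /= /andP[_ Di] Ait]; exists i.
Qed.

End union_bounds.

Section iid_bounds.
Context (R : realType) d (T : measurableType d).
Implicit Types P Q : probability T R.

Lemma iid_prob_consE P n (A : set (n.+1.-tuple T)) :
  iid_prob P n.+1 A = prod_prob P (iid_prob P n) [set w | A (tuple_cons w)].
Proof. by []. Qed.

Lemma measurable_sum_tnth n (g : 'I_n -> T -> R) :
  (forall i, measurable_fun setT (g i)) ->
  measurable_fun setT (fun t : n.-tuple T => \sum_i g i (tnth t i)).
Proof.
move=> mg; apply: measurable_sum => i.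
exact: (measurableT_comp (mg i) (measurable_tnth i)).
Qed.

(* Markov's inequality for [expR (\sum_i g i)], by induction on the number of factors. *)
Lemma iid_chernoff P n (g : 'I_n -> T -> R) (M : 'I_n -> R) (s : R) :
  (forall i, measurable_fun setT (g i)) ->
  (forall i, (\int[P]_x (expR (g i x))%:E <= (M i)%:E)%E) ->
  (iid_prob P n [set t | (s <= \sum_i g i (tnth t i))%R] <=
     ((\prod_i M i) * expR (- s))%:E)%E.
Proof.
elim: n g M s => [|n IH] g M s mg hM.
  rewrite big_ord0 mul1r /= diracE lee_fin.
  have [s0|s0] := leP s 0.
    apply: (@le_trans _ _ 1); first by case: (_ \in _).
    by rewrite -[leLHS]expR0 ler_expR oppr_ge0.
  rewrite memNset ?expR_ge0//=.
  by rewrite big_ord0 leNgt s0.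
have M0 i : 0 <= M i.
  rewrite -lee_fin; apply: le_trans (hM i).
  by apply: integral_ge0 => x _; rewrite lee_fin expR_ge0.
set A := [set t : n.+1.-tuple T | _].
have mA : measurable [set w | A (tuple_cons w)].
  apply: measurable_preimage; first exact: measurable_tuple_cons.
  exact: measurable_ge_fun (measurable_sum_tnth mg).
rewrite iid_prob_consE// prod_probE.
set c := (\prod_(i < n) M (lift ord0 i)) * expR (- s).
have c0 : 0 <= c by rewrite mulr_ge0 ?expR_ge0// prodr_ge0.
have mexp : measurable_fun setT (fun x => (expR (g ord0 x))%:E).
  by apply/measurable_EFinP; apply: measurableT_comp; [exact: measurable_expR|exact: mg].
apply: (@le_trans _ _ (\int[P]_x (c%:E * (expR (g ord0 x))%:E))%E).
  apply: ge0_le_integral => //.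
  - exact: measurable_fun_section mA.
  - exact: measurable_funeM.
  - move=> x _.
    have h := IH (fun i => g (lift ord0 i)) (fun i => M (lift ord0 i)) (s - g ord0 x)
      (fun i => mg _) (fun i => hM _).
    rewrite -EFinM /c -mulrA -expRD addrC -opprB; apply: le_trans h.
    rewrite le_eqVlt; apply/orP; left; apply/eqP; congr (iid_prob P n _).
    have sumE t : \sum_i g i (tnth (tuple_cons (x, t)) i) =
        g ord0 x + \sum_(i < n) g (lift ord0 i) (tnth t i).
      rewrite big_ord_recl tnth0; congr (_ + _).
      by apply: eq_bigr => i _; rewrite /= tnthS.
    by apply/seteqP; split => t; rewrite /A /= sumE lerBlDl.
rewrite ge0_integralZl//=.
rewrite big_ord_recl -mulrA -/c (mulrC (M _)) (EFinM c); exact: lee_wpmul2l.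
Qed.

Lemma measurable_tnth_in n (A : set T) (i : 'I_n) : measurable A ->
  measurable [set t : n.-tuple T | A (tnth t i)].
Proof. by apply: measurable_preimage; exact: measurable_tnth. Qed.

Lemma iid_exists_cons n (A : set T) (w : T * n.-tuple T) :
  (exists i, A (tnth (tuple_cons w) i)) <->
  A w.1 \/ exists i, A (tnth w.2 i).
Proof.
case: w => x t; split=> /= [[i]|[Ax|[i Ai]]].
- case: (unliftP ord0 i) => [j|] ->; last by left.
  by rewrite tnthS => Aj; right; exists j.
- by exists ord0.
- by exists (lift ord0 i); rewrite tnthS.
Qed.

Lemma measurable_iid_exists n (A : set T) : measurable A ->
  measurable [set t : n.-tuple T | exists i, A (tnth t i)].
Proof.
move=> mA; rewrite (_ : mkset _ =
  [set t : n.-tuple T | exists2 i, predT i & A (tnth t i)]).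
  by apply: measurable_exists => i; exact: measurable_tnth_in.
by apply/seteqP; split => t [i]; [exists i | move=> _; exists i].
Qed.

Lemma iid_exists_le P n (A : set T) (q : R) :
  measurable A -> (P A <= q%:E)%E ->
  (iid_prob P n [set t | exists i, A (tnth t i)] <= (n%:R * q)%:E)%E.
Proof.
move=> mA PA.
have q0 : 0 <= q by rewrite -lee_fin (le_trans _ PA).
elim: n => [|n IH].
  by rewrite (_ : [set _ | _] = set0) ?measure0 ?mul0r// -subset0 => t [[]].
rewrite iid_prob_consE -natr1 mulrDl mul1r addrC.
have mAn := measurable_iid_exists (n := n) mA.
apply: (@prod_prob_le _ _ _ _ _ _ _ _ A) => //.
- exact: (measurable_preimage (@measurable_tuple_cons _ T n)
    (measurable_iid_exists mA)).
- by rewrite mulr_ge0.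
- move=> x nAx; apply: prob_le IH => //.
    apply: (measurable_section (A := [set w : T * n.-tuple T |
      exists i, A (tnth (tuple_cons w) i)])).
    exact: (measurable_preimage (@measurable_tuple_cons _ T n)
      (measurable_iid_exists mA)).
  by move=> t /iid_exists_cons[|].
Qed.

(** Only pairs with [i < j] count, so [K] need not be symmetric, and its probability has to be
    controlled only for a fixed good first component. *)
Definition conflict n (B : set T) (K : set (T * T)) : set (n.-tuple T) :=
  [set t | exists i, B (tnth t i)] `|`
  [set t | exists i j : 'I_n, (i < j)%N /\ K (tnth t i, tnth t j)].

Lemma measurable_conflict n B K : measurable B -> measurable K ->
  measurable (conflict (n := n) B K).
Proof.
move=> mB mK; apply: measurableU; first exact: measurable_iid_exists.
rewrite (_ : [set t | _] = [set t : n.-tuple T |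
   exists2 ij : 'I_n * 'I_n, (ij.1 < ij.2)%N & K (tnth t ij.1, tnth t ij.2)]).
  apply: (@measurable_exists _ _ _ (fun ij : 'I_n * 'I_n => (ij.1 < ij.2)%N)
    (fun ij => [set t : n.-tuple T | K (tnth t ij.1, tnth t ij.2)])) => -[i j].
  apply: measurable_preimage mK.
  by apply/measurable_fun_pairP; split; exact: measurable_tnth.
by apply/seteqP; split => t /= => [[i [j [ij k]]]|[[i j] ij k]];
  [exists (i, j)|exists i, j].
Qed.

(* Exposing the samples one by one, a new sample conflicts with a given good
   one with probability at most [q2]. *)
Lemma iid_conflict_le P n (B : set T) (K : set (T * T)) (q1 q2 : R) :
  measurable B -> measurable K -> 0 <= q2 -> (P B <= q1%:E)%E ->
  (forall x, ~ B x -> (P [set y | K (x, y)] <= q2%:E)%E) ->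
  (iid_prob P n (conflict B K) <= (n%:R * q1 + n%:R ^+ 2 * q2)%:E)%E.
Proof.
move=> mB mK q20 PB PK.
have q10 : 0 <= q1 by rewrite -lee_fin (le_trans _ PB).
elim: n => [|n IH].
  rewrite (_ : conflict B K = set0) ?measure0 ?lee_fin ?addr_ge0 ?mulr_ge0//.
  by rewrite -subset0 => t [[[]]|[[]]].
rewrite iid_prob_consE.
(* The head is bad, or the tail has a conflict, or the head clashes with one of the [n] tail
   samples; [n ^ 2 + n <= (n + 1) ^ 2] closes the induction. *)
apply: (@le_trans _ _ (q1 + ((n%:R * q1 + n%:R ^+ 2 * q2) + n%:R * q2))%:E); last first.
  have := ler0n R n; rewrite lee_fin -natr1; nra.
have mC : measurable [set w : T * n.-tuple T | conflict B K (tuple_cons w)].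
  apply: measurable_preimage; first exact: measurable_tuple_cons.
  exact: measurable_conflict.
apply: (@prod_prob_le _ _ _ _ _ _ _ _ B) => //.
  by rewrite !addr_ge0 ?mulr_ge0 ?exprn_ge0.
move=> x nBx; set E := [set y | _].
apply: (@prob_le _ _ _ _ E (conflict B K `|`
    [set t | exists i, [set y | K (x, y)] (tnth t i)])).
- exact: (measurable_section (A := [set w : T * n.-tuple T | conflict B K (tuple_cons w)])).
- apply: measurableU; first exact: measurable_conflict.
  by apply: measurable_iid_exists; exact: measurable_section.
- move=> t /= [/iid_exists_cons[//|h]|[i [j []]]]; first by left; left.
  case: (unliftP ord0 j) => [j'|] ->; last by rewrite ltn0.
  case: (unliftP ord0 i) => [i'|] ->.
    by rewrite /= ltnS !tnthS => ij h; left; right; exists i', j'.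
  by move=> _; rewrite tnthS tnth0 => h; right; exists j'.
- apply: prob_setU_le => //.
  + exact: measurable_conflict.
  + by apply: measurable_iid_exists; exact: measurable_section.
  + by apply: iid_exists_le; [exact: measurable_section|exact: PK].
Qed.

End iid_bounds.

(** * Gaussian tails *)

Section gaussian_moments.
Context (R : realType).
Local Notation mu := (@lebesgue_measure R).

(** The Radon-Nikodym derivative agrees with the density only almost everywhere, because both have
    the same integral over every measurable set; this is enough under the integral. *)
Lemma ge0_integral_normal_prob (m s : R) (f : R -> R) :
  (forall x, 0 <= f x) -> measurable_fun setT f ->
  (\int[normal_prob m s]_x (f x)%:E =
   \int[mu]_x (f x * normal_pdf m s x)%:E)%E.
Proof.
move=> f0 mf.
have dom := normal_prob_dominates m s.
rewrite -(Radon_Nikodym_SigmaFinite.change_of_variables dom)//; last exact/measurable_EFinP.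
have mpdf : measurable_fun setT (fun x => (normal_pdf m s x)%:E).
  by apply/measurable_EFinP; exact: measurable_normal_pdf.
have mRN := measurable_int _ (Radon_Nikodym_SigmaFinite.f_integrable dom).
apply: ae_eq_integral => //.
- by apply: emeasurable_funM => //; exact/measurable_EFinP.
- apply/measurable_EFinP; apply: measurable_funM => //.
  exact: measurable_normal_pdf.
under [X in ae_eq _ _ _ X]eq_fun do rewrite EFinM.
apply: ae_eqe_mul2l; apply: integral_ae_eq => //.
  exact: Radon_Nikodym_SigmaFinite.f_integrable.
by move=> E _ mE; rewrite -Radon_Nikodym_SigmaFinite.f_integral.
Qed.

Lemma gaussian_mgf (l : R) :
  (\int[normal_prob 0 1]_x (expR (l * x))%:E <= (expR (l ^+ 2 / 2))%:E)%E.
Proof.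
rewrite ge0_integral_normal_prob//=; last first.
  by apply: measurableT_comp => //; exact: measurable_funM.
under eq_integral => x _.
  (* Completing the square: the tilted density is a multiple of the density centred at [l]. *)
  rewrite (_ : _ * _ = expR (l ^+ 2 / 2) * normal_pdf l 1 x); last first.
    rewrite !normal_pdfE ?oner_eq0// mulrCA [RHS]mulrCA -!expRD.
    by congr (_ * expR _); field.
  rewrite EFinM.
  over.
rewrite integralZl//; last exact: integrable_normal_pdf.
by rewrite integral_normal_pdf mule1.
Qed.

(** This exponent turns the standard density into [s] times the density of standard deviation [s].
    It is positive for [s > 1] and negative for [s < 1], which gives the upper and the lower tail of
    the norm. *)
Lemma gaussian_sqr_mgf (s : R) : 0 < s ->
  (\int[normal_prob 0 1]_x (expR ((1 - s ^- 2) / 2 * x ^+ 2))%:E <= s%:E)%E.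
Proof.
move=> s0.
rewrite ge0_integral_normal_prob//=; last first.
  by apply: measurableT_comp => //; apply: measurable_funM => //; exact: measurable_funX.
under eq_integral => x _.
  rewrite (_ : _ * _ = s * normal_pdf 0 s x); last first.
    rewrite !normal_pdfE ?oner_eq0 ?gt_eqF//.
    have -> : normal_peak 1 = s * normal_peak s.
      rewrite /normal_peak expr1n mul1r -mulrnAr sqrtrM ?sqr_ge0//.
      by rewrite sqrtr_sqr gtr0_norm// invfM mulrA divff ?mul1r// gt_eqF.
    rewrite /normal_fun mulrCA -(mulrA s) -expRD; congr (_ * (_ * expR _)).
    by field; rewrite gt_eqF.
  rewrite EFinM.
  over.
rewrite integralZl//; last exact: integrable_normal_pdf.
by rewrite integral_normal_pdf mule1.
Qed.

End gaussian_moments.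

Section gaussian_tails.
Context (R : realType) (d : nat).
Local Notation G := (iid_prob (normal_prob (0 : R) 1) d).

Lemma standard_gaussian_tail (a : 'I_d -> R) (s V : R) : 0 < s -> 0 < V ->
  \sum_i a i ^+ 2 <= V ->
  (G [set z | (s <= \sum_i a i * tnth z i)%R] <= (expR (- (s ^+ 2 / (2 * V))))%:E)%E.
Proof.
(* [s / V] minimizes the Chernoff exponent [l ^ 2 * V / 2 - l * s]. *)
move=> s0 V0 aV; pose l := s / V.
have l0 : 0 < l by rewrite divr_gt0.
have -> : [set z : d.-tuple (measurableTypeR R) | (s <= \sum_i a i * tnth z i)%R] =
    [set z : d.-tuple (measurableTypeR R) | (l * s <= \sum_i (l * a i) * tnth z i)%R].
  have lE (z : d.-tuple (measurableTypeR R)) :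
      \sum_i (l * a i) * tnth z i = l * \sum_i a i * tnth z i.
    by rewrite mulr_sumr; apply: eq_bigr => i _; rewrite mulrA.
  by apply/seteqP; split => z /=; rewrite lE ler_pM2l.
apply: le_trans (iid_chernoff (P := normal_prob 0 1)
  (g := fun i (z : measurableTypeR R) => l * a i * z)
  (M := fun i => expR ((l * a i) ^+ 2 / 2)) (l * s) _ _) _ => //.
- by move=> i; exact: measurable_funM.
- by move=> i; exact: gaussian_mgf.
rewrite lee_fin -expR_sum -expRD ler_expR -mulr_suml.
under eq_bigr do rewrite exprMn.
rewrite -mulr_sumr.
apply: (@le_trans _ _ (l ^+ 2 * V / 2 - l * s)).
  by rewrite lerD2r ler_pM2r// ler_pM2l// exprn_gt0.
by rewrite le_eqVlt; apply/orP; left; apply/eqP; rewrite /l; field; rewrite gt_eqF.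
Qed.

Lemma standard_gaussian_norm_ub :
  (G [set z | (4 * d%:R <= \sum_i (tnth z i) ^+ 2)%R] <= (expR (- (d%:R / 2)))%:E)%E.
Proof.
(* [gaussian_sqr_mgf] with standard deviation 2: each coordinate contributes a factor [2 <= e], and
   the threshold contributes [exp (- 3 d / 2)]. *)
pose l : R := (1 - 2 ^- 2) / 2.
have lE : l = 3 / 8 by rewrite /l; field.
have -> : [set z : d.-tuple (measurableTypeR R) | (4 * d%:R <= \sum_i (tnth z i) ^+ 2)%R] =
    [set z : d.-tuple (measurableTypeR R) | (l * (4 * d%:R) <= \sum_i l * (tnth z i) ^+ 2)%R].
  by apply/seteqP; split => z /=; rewrite -mulr_sumr ler_pM2l// lE.
apply: le_trans (iid_chernoff (P := normal_prob 0 1)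
  (g := fun i (z : measurableTypeR R) => l * z ^+ 2)
  (M := fun i => 2) (l * (4 * d%:R)) _ _) _ => //.
- by move=> i; apply: measurable_funM => //; exact: measurable_funX.
- by move=> i; exact: gaussian_sqr_mgf.
rewrite lee_fin prodr_const card_ord.
have e2 : 2 <= expR 1 :> R by have := @expR_ge1Dx R 1; rewrite (_ : 1 + 1 = 2).
apply: (@le_trans _ _ (expR 1 ^+ d * expR (- (l * (4 * d%:R))))).
  by rewrite ler_pM2r ?expR_gt0// lerXn2r ?nnegrE// expR_ge0.
by rewrite -expRM_natl -expRD ler_expR lE; lra.
Qed.

Lemma standard_gaussian_norm_lb :
  (G [set z | (\sum_i (tnth z i) ^+ 2 <= d%:R / 8)%R] <= (expR (- (d%:R / 4)))%:E)%E.
Proof.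
(* Standard deviation 1/2: each coordinate contributes [1 / 2 <= exp (- 1 / 2)], against a loss of
   only [exp (3 d / 16)] from the threshold. *)
pose l : R := (1 - (2^-1) ^- 2) / 2.
have lE : l = - 3 / 2 by rewrite /l; field.
have -> : [set z : d.-tuple (measurableTypeR R) | (\sum_i (tnth z i) ^+ 2 <= d%:R / 8)%R] =
    [set z : d.-tuple (measurableTypeR R) | (l * (d%:R / 8) <= \sum_i l * (tnth z i) ^+ 2)%R].
  by apply/seteqP; split => z /=; rewrite -mulr_sumr ler_nM2l// lE; lra.
apply: le_trans (iid_chernoff (P := normal_prob 0 1)
  (g := fun i (z : measurableTypeR R) => l * z ^+ 2)
  (M := fun i => 2^-1) (l * (d%:R / 8)) _ _) _ => //.
- by move=> i; apply: measurable_funM => //; exact: measurable_funX.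
- by move=> i; exact: gaussian_sqr_mgf.
rewrite lee_fin prodr_const card_ord.
have e2 : 2^-1 <= expR (- 2^-1) :> R.
  by have := @expR_ge1Dx R (- 2^-1); lra.
apply: (@le_trans _ _ (expR (- 2^-1) ^+ d * expR (- (l * (d%:R / 8))))).
  by rewrite ler_pM2r ?expR_gt0// lerXn2r ?nnegrE// expR_ge0.
by rewrite -expRM_natl -expRD ler_expR lE; have := ler0n R d; lra.
Qed.

End gaussian_tails.

Section measurable_matrix.
Context (R : realType) d (T : measurableType d).

Lemma measurable_dotp n (f g : T -> 'cV[R]_n) :
  measurable_fun setT f -> measurable_fun setT g ->
  measurable_fun setT (fun x => dotp (f x) (g x)).
Proof.
move=> /measurable_fun_mxP mf /measurable_fun_mxP mg.
under eq_fun do rewrite dotpE.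
by apply: measurable_sum => i; exact: measurable_funM.
Qed.

Lemma measurable_mulmx m n p (f : T -> 'M[R]_(m, n)) (g : T -> 'M[R]_(n, p)) :
  measurable_fun setT f -> measurable_fun setT g ->
  measurable_fun setT (fun x => f x *m g x).
Proof.
move=> /measurable_fun_mxP mf /measurable_fun_mxP mg.
apply/measurable_fun_mxP => i j; under eq_fun do rewrite mxE.
by apply: measurable_sum => k; exact: measurable_funM.
Qed.

Lemma measurable_le_fun (f : T -> R) s :
  measurable_fun setT f -> measurable [set x | f x <= s].
Proof.
by move=> mf; rewrite -[X in measurable X]setTI; exact: measurable_fun_le.
Qed.

End measurable_matrix.

Section noise_tails.
Context (R : realType) (d : nat) (rho : R) (mu1 mu2 : 'cV[R]_d).
Hypotheses (rho0 : 0 < rho) (mu12 : dotp mu1 mu2 = 0)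
  (mu1rho : l2norm mu1 = rho) (mu2rho : l2norm mu2 = rho).
Local Notation P := (noise_cov rho mu1 mu2).
Local Notation N := (gaussian P).

Lemma gaussianE (A : 'M[R]_d) (B : set 'cV[R]_d) :
  gaussian A B =
  iid_prob (normal_prob (0 : R) 1) d [set z | B (linear_image A z)].
Proof. by []. Qed.

Lemma measurable_linear_preimage (A : 'M[R]_d) (B : set 'cV[R]_d) :
  measurable B -> measurable [set z | B (linear_image A z)].
Proof. by apply: measurable_preimage; exact: measurable_linear_image. Qed.

Lemma gaussian_sub_le (B : set 'cV[R]_d) (B' : set (d.-tuple (measurableTypeR R)))
    (q : R) :
  measurable B -> measurable B' ->
  (forall z, B (linear_image P z) -> B' z) ->
  (iid_prob (normal_prob (0 : R) 1) d B' <= q%:E)%E -> (N B <= q%:E)%E.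
Proof.
move=> mB mB' BB'; rewrite gaussianE; apply: prob_le => //.
exact: measurable_linear_preimage.
Qed.

Lemma measurable_dotpr (a : 'cV[R]_d) : measurable_fun setT (dotp a).
Proof. by apply: (@measurable_dotp _ _ _ _ (cst a) id) => //; exact: measurable_id. Qed.

Lemma measurable_sqnorm : measurable_fun setT (fun x : 'cV[R]_d => dotp x x).
Proof. by apply: (@measurable_dotp _ _ _ _ id id); exact: measurable_id. Qed.

Lemma measurable_linear_form (a : 'I_d -> R) : measurable_fun setT
  (fun z : d.-tuple (measurableTypeR R) => \sum_i a i * tnth z i).
Proof.
apply: measurable_sum => i; apply: measurable_funM => //.
exact: measurable_tnth.
Qed.

Lemma measurable_sum_sqr : measurable_fun setT
  (fun z : d.-tuple (measurableTypeR R) => \sum_i tnth z i ^+ 2).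
Proof.
apply: measurable_sum => i; apply: measurable_funX.
exact: measurable_tnth.
Qed.

(** The symmetric projection moves to the other side, [<a, P z> = <P a, z>], and does not increase
    the norm of [a]. *)
Lemma noise_dotp_tail (a : 'cV[R]_d) (s V : R) : 0 < s -> 0 < V ->
  dotp a a <= V ->
  (N [set x | (s <= dotp a x)%R] <= (expR (- (s ^+ 2 / (2 * V))))%:E)%E.
Proof.
move=> s0 V0 aV.
apply: gaussian_sub_le (standard_gaussian_tail (a := fun i => (P *m a) i 0) s0 V0 _).
- exact: measurable_ge_fun (measurable_dotpr a).
- exact: measurable_ge_fun (measurable_linear_form _).
- move=> z /=; rewrite dotp_mulmxr noise_cov_tr dotpE => h; apply: (le_trans h).
  rewrite le_eqVlt; apply/orP; left; apply/eqP.
  by apply: eq_bigr => i _; congr (_ * _); rewrite mxE.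
- apply: le_trans aV; apply: le_trans (dotp_noise_cov_le rho0 mu12 mu1rho mu2rho a).
  rewrite dotpE le_eqVlt; apply/orP; left; apply/eqP.
  by apply: eq_bigr => i _; rewrite expr2.
Qed.

Lemma noise_dotp_abs_tail (a : 'cV[R]_d) (s V : R) : 0 < s -> 0 < V ->
  dotp a a <= V ->
  (N [set x | (s <= `|dotp a x|)%R] <= (2 * expR (- (s ^+ 2 / (2 * V))))%:E)%E.
Proof.
move=> s0 V0 aV.
have mge b : measurable [set x : 'cV[R]_d | s <= dotp b x].
  exact: measurable_ge_fun (measurable_dotpr b).
rewrite mulr2n mulrDl mul1r.
apply: (@prob_le _ _ _ _ _
  ([set x | (s <= dotp a x)%R] `|` [set x | (s <= dotp (- a) x)%R])).
- apply: measurable_ge_fun; apply: measurableT_comp; last exact: measurable_dotpr.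
  exact: normr_measurable.
- exact: measurableU.
- by move=> x /=; rewrite dotpNl ler_normr => /orP[]; [left|right].
- apply: prob_setU_le => //; first exact: noise_dotp_tail.
  by apply: noise_dotp_tail => //; rewrite dotpNl dotpNr opprK.
Qed.

Lemma noise_norm_ub :
  (N [set x | (4 * d%:R <= dotp x x)%R] <= (expR (- (d%:R / 2)))%:E)%E.
Proof.
apply: gaussian_sub_le (standard_gaussian_norm_ub R d).
- exact: measurable_ge_fun measurable_sqnorm.
- exact: measurable_ge_fun measurable_sum_sqr.
- move=> z /= h; apply: (le_trans h).
  rewrite (le_trans (dotp_noise_cov_le rho0 mu12 mu1rho mu2rho _))//.
  rewrite dotpE le_eqVlt; apply/orP; left; apply/eqP.
  by apply: eq_bigr => i _; rewrite !mxE expr2.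
Qed.

(* [|P z|^2] is [|z|^2] minus the squares of two standard Gaussian coordinates. *)
Lemma noise_norm_lb : (0 < d)%N ->
  (N [set x | (dotp x x <= d%:R / 16)%R]
    <= (expR (- (d%:R / 4)) + 4 * expR (- (d%:R / 64)))%:E)%E.
Proof.
move=> d0; have dp : 0 < d%:R :> R by rewrite ltr0n.
(* If [|z|^2 > d / 8] and both squared signal coordinates are below [d / 32], what remains is more
   than [d / 16]. *)
pose s : R := Num.sqrt (d%:R / 32).
have s0 : 0 < s by rewrite sqrtr_gt0 divr_gt0.
have ssq : s ^+ 2 = d%:R / 32 by rewrite sqr_sqrtr// divr_ge0.
have mle a : measurable [set z : d.-tuple (measurableTypeR R) |
    (s <= \sum_i a i * tnth z i)%R].
  exact: measurable_ge_fun (measurable_linear_form _).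
have tail (b : R) (mu : 'cV[R]_d) : b ^+ 2 = 1 -> l2norm mu = rho ->
  (iid_prob (normal_prob (0 : R) 1) d
   [set z | (s <= \sum_i (b * mu i 0 / rho) * tnth z i)%R]
     <= (expR (- (d%:R / 64)))%:E)%E.
  move=> b1 hmu.
  have -> : d%:R / 64 = s ^+ 2 / (2 * 1) by rewrite ssq; field.
  apply: standard_gaussian_tail => //.
  under eq_bigr do rewrite !exprMn b1 mul1r.
  rewrite -mulr_suml exprVn ler_pdivrMr ?exprn_gt0// mul1r -hmu l2norm_sqr dotpE.
  by under [leRHS]eq_bigr do rewrite -expr2.
apply: (@gaussian_sub_le _ ([set z | (\sum_i (tnth z i) ^+ 2 <= d%:R / 8)%R] `|`
   (([set z | (s <= \sum_i (1 * mu1 i 0 / rho) * tnth z i)%R] `|`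
    [set z | (s <= \sum_i (-1 * mu1 i 0 / rho) * tnth z i)%R]) `|`
   ([set z | (s <= \sum_i (1 * mu2 i 0 / rho) * tnth z i)%R] `|`
    [set z | (s <= \sum_i (-1 * mu2 i 0 / rho) * tnth z i)%R])))).
- exact: measurable_le_fun measurable_sqnorm.
- by apply: measurableU; [exact: measurable_le_fun measurable_sum_sqr|
    do 2! apply: measurableU].
- move=> z.
  rewrite /= dotp_noise_cov//.
  set zz := \col_i tnth z i.
  have -> : dotp zz zz = \sum_i (tnth z i) ^+ 2.
    by rewrite dotpE; apply: eq_bigr => i _; rewrite !mxE expr2.
  have sumE (b : R) (mu : 'cV[R]_d) :
      \sum_i (b * mu i 0 / rho) * tnth z i = b * (dotp mu zz / rho).
    by rewrite dotpE mulr_suml mulr_sumr; apply: eq_bigr => i _; rewrite !mxE; ring.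
  rewrite !sumE !mul1r !mulN1r.
  move=> h.
  have [|h1] := leP (\sum_i tnth z i ^+ 2) (d%:R / 8); first by left.
  right.
  have [h2|h2] := leP (d%:R / 32) ((dotp mu1 zz / rho) ^+ 2).
    left; apply/orP; rewrite -ler_normr -(@ler_pXn2r _ 2)// ?nnegrE ?(ltW s0)// ssq.
    by rewrite real_normK ?num_real.
  have h3 : (d%:R / 32) <= ((dotp mu2 zz / rho) ^+ 2) by lra.
  right; apply/orP; rewrite -ler_normr -(@ler_pXn2r _ 2)// ?nnegrE ?(ltW s0)// ssq.
  by rewrite real_normK ?num_real.
- apply: prob_setU_le.
  + exact: measurable_le_fun measurable_sum_sqr.
  + by do 2! apply: measurableU.
  + exact: standard_gaussian_norm_lb.
  set e := expR _.
  rewrite (_ : 4 * e = (e + e) + (e + e)); last by ring.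
  by apply: prob_setU_le; [exact: measurableU|exact: measurableU|apply: prob_setU_le|
   apply: prob_setU_le] => //; apply: tail => //; ring.
Qed.

Definition bad_norm : set 'cV[R]_d :=
  [set x | 4 * d%:R <= dotp x x] `|` [set x | dotp x x <= d%:R / 16].

Lemma measurable_bad_norm : measurable bad_norm.
Proof.
apply: measurableU; [exact: measurable_ge_fun measurable_sqnorm|].
exact: measurable_le_fun measurable_sqnorm.
Qed.

Lemma noise_bad_norm_le : (0 < d)%N ->
  (N bad_norm <= (6 * expR (- (d%:R / 64)))%:E)%E.
Proof.
move=> d0; have dp : 0 < d%:R :> R by rewrite ltr0n.
have h1 : expR (- (d%:R / 2)) <= expR (- (d%:R / 64)) :> R by rewrite ler_expR; lra.
have h2 : expR (- (d%:R / 4)) <= expR (- (d%:R / 64)) :> R by rewrite ler_expR; lra.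
apply: (@le_trans _ _ (expR (- (d%:R / 2)) +
   (expR (- (d%:R / 4)) + 4 * expR (- (d%:R / 64))))%:E).
  apply: prob_setU_le.
  - exact: measurable_ge_fun measurable_sqnorm.
  - exact: measurable_le_fun measurable_sqnorm.
  - exact: noise_norm_ub.
  - exact: noise_norm_lb.
by rewrite lee_fin; lra.
Qed.

End noise_tails.

(** * Margin-maximizing solutions on a good training set *)

Section attention.
Context (R : realType) (T d : nat).
Implicit Types (X : 'M[R]_(T, d)) (v p : 'cV[R]_d).

Definition token X (j : 'I_T) : 'cV[R]_d := (row j X)^T.

Lemma mulmx_token X (v : 'cV[R]_d) j : (X *m v) j 0 = dotp v (token X j).
Proof.
by rewrite dotpE mxE; apply: eq_bigr => k _; rewrite !mxE mulrC.
Qed.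

Lemma attnE X v p : attn X v p =
  (\sum_j expR (dotp p (token X j)) * dotp v (token X j)) /
  \sum_j expR (dotp p (token X j)).
Proof.
rewrite /attn -trmx_mul mxE mulr_suml; apply: eq_bigr => j _.
rewrite mxE mulmx_token /softmax mxE mulmx_token mulrA [dotp v _ * _]mulrC.
by congr (_ / _); apply: eq_bigr => k _; rewrite mulmx_token.
Qed.

Lemma sum_expR_gt0 X p (j : 'I_T) : 0 < \sum_j expR (dotp p (token X j)).
Proof.
rewrite (bigD1 j)//= ltr_pwDl ?expR_gt0// ?sumr_ge0//.
Qed.

(** Clearing the positive softmax denominator makes the constraint linear in the exponential
    weights. The index [j] only witnesses that there is a token, hence that the denominator is not
    0. *)
Lemma margin_geE X v p (y g : R) (j : 'I_T) :
  (g <= y * attn X v p) =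
  (0 <= \sum_j expR (dotp p (token X j)) * (y * dotp v (token X j) - g)).
Proof.
rewrite attnE mulrA ler_pdivlMr ?sum_expR_gt0//.
rewrite -subr_ge0; congr (0 <= _).
rewrite !mulr_sumr -sumrB; apply: eq_bigr => k _; ring.
Qed.

End attention.

(** * Margins of softmax averages *)

Section softmax_margin.
Context (R : realType) (m : nat) (e a : 'I_m.+1 -> R) (g : R).
Implicit Types (j : 'I_m.+1) (L t B : R).

(** The excess [t * g] of token [j0] pays for the [m] others, each of which falls short by at most
    [(B + 1) * g] and has relative weight at most [expR (- L)]. *)
Lemma margin_gap_ge0 j0 L t B : 0 <= g -> 0 <= B ->
  (1 + t) * g <= a j0 -> (forall j, - (B * g) <= a j) ->
  (forall j, j != j0 -> e j + L <= e j0) ->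
  m%:R * (B + 1) * expR (- L) <= t ->
  0 <= \sum_j expR (e j) * (a j - g).
Proof.
move=> g0 B0 h1 h2 h3 h4.
rewrite (bigD1 j0)//=.
have s0 : expR (e j0) * (t * g) <= expR (e j0) * (a j0 - g).
  by rewrite ler_pM2l ?expR_gt0//; nra.
have s1 : - (m%:R * (expR (e j0) * expR (- L) * ((B + 1) * g))) <=
    \sum_(j | j != j0) expR (e j) * (a j - g).
  have -> : m%:R = (\sum_(j | j != j0) 1 : R).
    rewrite sumr_const; congr _%:R.
    have h : #|predC1 j0| = m by rewrite cardC1 card_ord.
    by rewrite -[LHS]h; apply: eq_card => j; rewrite !inE.
  rewrite mulr_suml -sumrN; apply: ler_sum => j jj0; rewrite mul1r.
  have ej : expR (e j) <= expR (e j0) * expR (- L).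
    by rewrite -expRD ler_expR lerBrDr h3.
  have aj := h2 j.
  have hB : 0 <= (B + 1) * g by rewrite mulr_ge0// addr_ge0.
  have e0 := expR_ge0 (e j).
  apply: (@le_trans _ _ (- (expR (e j) * ((B + 1) * g)))).
    by rewrite lerN2 ler_wpM2r.
  by rewrite -mulrN ler_wpM2l//; lra.
apply: le_trans (lerD s0 s1).
have -> : expR (e j0) * (t * g) - m%:R * (expR (e j0) * expR (- L) * ((B + 1) * g)) =
  expR (e j0) * (g * (t - m%:R * (B + 1) * expR (- L))) by ring.
by rewrite !mulr_ge0 ?expR_ge0// subr_ge0.
Qed.

Lemma margin_ge0_exists : 0 <= \sum_j expR (e j) * (a j - g) -> exists j, g <= a j.
Proof.
move=> h; apply: contrapT => /forallNP nh.
suff : \sum_j expR (e j) * (a j - g) < 0 by rewrite ltNge h.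
have lt0 j : expR (e j) * (a j - g) < 0.
  by rewrite pmulr_rlt0 ?expR_gt0// subr_lt0 ltNge; apply/negP/nh.
rewrite (bigD1 ord0)//= -[ltRHS]addr0; apply: ltr_leD => //.
by apply: sumr_le0 => j _; exact: ltW.
Qed.

(** When all tokens but [j0] have value at most [g / 2], each of them lowers the weighted sum by at
    least half its weight times [g], and only the excess of [j0] can make up for it. A small excess
    thus forces a large score gap. *)
Lemma margin_ge0_score j0 j : 0 <= g ->
  0 <= \sum_j expR (e j) * (a j - g) -> j != j0 ->
  (forall k, k != j0 -> a k <= g / 2) ->
  expR (e j) * (g / 2) <= expR (e j0) * (a j0 - g).
Proof.
move=> g0 + jj0 ha; rewrite (bigD1 j0)//= (bigD1 j jj0)/= => h.
have s : \sum_(k | (k != j0) && (k != j)) expR (e k) * (a k - g) <= 0.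
  apply: sumr_le0 => k /andP[kj0 _].
  by have := ha k kj0; have := expR_gt0 (e k); nra.
have := ha j jj0; have := expR_gt0 (e j); nra.
Qed.

End softmax_margin.

(** * Cost comparisons on a fixed training set *)

Section training_set.
Context (R : realType) (d n m : nat) (rho theta : R) (mu1 mu2 : 'cV[R]_d).
Context (S : n.-tuple ('M[R]_(m.+1, d) * R)).
Context (b : 'I_n -> bool) (pos : 'I_n -> 'I_m.+1).
Implicit Types (i : 'I_n) (j : 'I_m.+1) (v p : 'cV[R]_d).
Local Notation x i j := (token (tnth S i).1 j).
Local Notation y i := (tnth S i).2.
Local Notation mu := (fun c : bool => if c then mu1 else mu2).
Local Notation P := (noise_cov rho mu1 mu2).
(** Scaled so that [n * m.+1] overlaps amount to [d / 256], hence the noise tokens satisfy Bessel's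
    inequality with constant [5 * d], and so that [n] overlaps weighted by [128 / d] amount to at
    most 1/2. *)
Local Notation cross := (d%:R / (256 * (n%:R * m.+1%:R)) : R).

Definition noisy i := y i != pm1 R (b i).

Hypotheses (rho0 : 0 < rho) (mu12 : dotp mu1 mu2 = 0)
  (mu1rho : l2norm mu1 = rho) (mu2rho : l2norm mu2 = rho).
Hypotheses (n0 : (0 < n)%N) (m0 : (0 < m)%N) (d0 : (0 < d)%N).
Hypothesis y_pm1 : forall i, y i = 1 \/ y i = -1.
Hypothesis x_pos : forall i, x i (pos i) = mu (b i).
Hypothesis x_orth : forall i j, j != pos i ->
  dotp mu1 (x i j) = 0 /\ dotp mu2 (x i j) = 0.
Hypothesis x_norm : forall i j, j != pos i ->
  d%:R / 16 <= dotp (x i j) (x i j) <= 4 * d%:R.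
Hypothesis x_cross : forall i j i' j', j != pos i -> j' != pos i' ->
  (i, j) != (i', j') -> `|dotp (x i j) (x i' j')| <= cross.
Hypothesis theta0 : 0 < theta.
(** The bound is the inequality [200 * theta < 1 / 8] that ends [solution_query]. In [theta_ge], the
    left-hand side bounds the squared norm of [query]: [8 * rho ^- 2] for two signals with
    coefficient [2 * rho ^- 2], and the rest for memorizing the noisy samples. *)
Hypothesis theta_small : theta < 40 ^- 2.
Hypothesis theta_ge :
  8 * rho ^- 2 + (5 * 128 ^+ 2) * (#|noisy|%:R / d%:R) <= theta * (n%:R / d%:R).
Hypothesis clean_ge : forall c,
  n%:R / 8 <= #|[pred i | (b i == c) && ~~ noisy i]|%:R :> R.

Let dp : 0 < d%:R :> R. Proof. by rewrite ltr0n. Qed.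
Let np : 0 < n%:R :> R. Proof. by rewrite ltr0n. Qed.
Let mp : 0 < m.+1%:R :> R. Proof. by rewrite ltr0n. Qed.

Lemma pm1_sqr c : pm1 R c * pm1 R c = 1.
Proof. by case: c; rewrite /pm1 ?mulrNN mulr1. Qed.

Lemma y_noisy i : noisy i -> y i = - pm1 R (b i).
Proof.
by rewrite /noisy /pm1; case: (y_pm1 i) => ->; case: (b i); rewrite ?opprK// eqxx.
Qed.

Lemma y_clean i : ~~ noisy i -> y i = pm1 R (b i).
Proof. by rewrite negbK => /eqP. Qed.

Lemma cross_ge0 : 0 <= cross.
Proof.
by apply: divr_ge0 => //; apply: mulr_ge0 => //; exact: mulr_ge0.
Qed.

(** The value 0 at signal positions lets the almost orthogonal family be indexed by all pairs. *)
Definition noise_token (ij : 'I_n * 'I_m.+1) : 'cV[R]_d :=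
  if ij.2 == pos ij.1 then 0 else x ij.1 ij.2.

Lemma noise_bessel v :
  \sum_i \sum_j dotp v (noise_token (i, j)) ^+ 2 <= 5 * d%:R * dotp v v.
Proof.
rewrite (pair_bigA _ (fun i j => dotp v (noise_token (i, j)) ^+ 2))/=.
under eq_bigr do rewrite -surjective_pairing.
apply: le_trans (almost_orthogonal_bessel (D := 4 * d%:R) (t := cross) v _ cross_ge0 _ _) _.
- by rewrite mulr_ge0.
- move=> [i j]; rewrite /noise_token/=; case: ifPn => h.
    by rewrite dotp0l mulr_ge0.
  by have /andP[] := x_norm h.
- move=> [i j] [i' j'] ne; rewrite /noise_token/=.
  case: ifPn => h; first by rewrite dotp0l normr0 cross_ge0.
  case: ifPn => h'; first by rewrite dotp0r normr0 cross_ge0.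
  exact: x_cross.
- rewrite card_prod !card_ord ler_wpM2r ?dotp_ge0// natrM.
  have -> : n%:R * m.+1%:R * cross = d%:R / 256 :> R.
    by field; rewrite !gt_eqF.
  have := dp; lra.
Qed.

Lemma exists_noise i : exists j, j != pos i.
Proof.
have : (0 < #|predC1 (pos i)|)%N by rewrite cardC1 card_ord.
by case/card_gt0P => j; rewrite inE => h; exists j.
Qed.

(** Each clean sample of the class contributes at least 1 to a sum that [noise_bessel] bounds. With
    two weights, each sample can be charged either to [v] or to [p]. *)
Lemma clean_class_le c v p (f g : R) :
  (forall i, b i = c -> ~~ noisy i -> exists2 j, j != pos i &
    1 <= f * dotp v (x i j) ^+ 2 + g * dotp p (x i j) ^+ 2) ->
  0 <= f -> 0 <= g ->
  n%:R / 8 <= 5 * d%:R * (f * dotp v v + g * dotp p p).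
Proof.
move=> h f0 g0.
apply: le_trans (clean_ge c) _.
apply: (@le_trans _ _ (\sum_i (\sum_j (f * dotp v (noise_token (i, j)) ^+ 2 +
    g * dotp p (noise_token (i, j)) ^+ 2)))).
  rewrite -sum1_card natr_sum big_mkcond/=; apply: ler_sum => i _.
  have t0 j : 0 <= f * dotp v (noise_token (i, j)) ^+ 2 +
      g * dotp p (noise_token (i, j)) ^+ 2.
    by rewrite addr_ge0// mulr_ge0// sqr_ge0.
  rewrite inE; case: ifPn => [/andP[/eqP bc cl]|_]; last exact: sumr_ge0.
  have [j jp hj] := h i bc cl.
  rewrite (bigD1 j)//= -[leLHS]addr0 lerD//.
    by rewrite /noise_token/= (negbTE jp).
  exact: sumr_ge0.
under eq_bigr do rewrite big_split/= -!mulr_sumr.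
rewrite big_split/= -!mulr_sumr.
have := ler_wpM2l f0 (noise_bessel v); have := ler_wpM2l g0 (noise_bessel p); lra.
Qed.

Section selection.
Context (sel : 'I_n -> 'I_m.+1) (s : 'I_n -> R).
Hypothesis sel_pos : forall i, noisy i -> sel i != pos i.
Hypothesis s_sqr : forall i, s i = 1 \/ s i = -1.

(* Each summand has value at least 8 on its own token, because [|x|^2 >= d / 16],
   and at most [1 / (2 n)] on any other noise token. *)
Definition memo : 'cV[R]_d :=
  \sum_(i | noisy i) (128 / d%:R * s i) *: x i (sel i).

Lemma s_abs i : `|s i| = 1.
Proof. by case: (s_sqr i) => ->; rewrite ?normrN normr1. Qed.

Lemma dotp_mu_memo : dotp mu1 memo = 0 /\ dotp mu2 memo = 0.
Proof.
by split; rewrite dotp_sumr big1// => i ni; rewrite dotpZr;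
  have [h1 h2] := x_orth (sel_pos ni); rewrite ?h1 ?h2 mulr0.
Qed.

Lemma memo_norm : dotp memo memo <= (5 * 128 ^+ 2) * (#|noisy|%:R / d%:R).
Proof.
pose w i := if noisy i then x i (sel i) else 0.
pose a i := if noisy i then 128 / d%:R * s i else 0.
have -> : memo = \sum_i a i *: w i.
  rewrite /memo big_mkcond; apply: eq_bigr => i _; rewrite /a /w.
  by case: ifP => //; rewrite scaler0.
apply: (le_trans (almost_orthogonal_norm (D := 4 * d%:R) (t := cross) a cross_ge0 _ _)).
- move=> i; rewrite /w; case: ifPn => h; last by rewrite dotp0l mulr_ge0.
  by have /andP[] := x_norm (sel_pos h).
- move=> i i' ne; rewrite /w.
  case: ifPn => h; last by rewrite dotp0l normr0 cross_ge0.
  case: ifPn => h'; last by rewrite dotp0r normr0 cross_ge0.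
  by apply: x_cross; rewrite ?sel_pos// xpair_eqE (negbTE ne).
have -> : \sum_i a i ^+ 2 = #|noisy|%:R * (128 / d%:R) ^+ 2.
  rewrite -sum1_card natr_sum mulr_suml [RHS]big_mkcond; apply: eq_bigr => i _.
  rewrite /a -topredE/=; case: (noisy i); last by rewrite expr2 mul0r.
  by rewrite exprMn -[s i ^+ 2]real_normK ?num_real// s_abs expr1n mulr1 mul1r.
rewrite card_ord.
have hc : n%:R * cross <= d%:R.
  have -> : n%:R * cross = d%:R / (256 * m.+1%:R) :> R.
    by field; rewrite !gt_eqF.
  have : 1 <= m.+1%:R :> R by rewrite ler1n.
  by move=> m1; rewrite ler_pdivrMr; [apply: ler_peMr => //; lra|lra].
apply: (@le_trans _ _ ((5 * d%:R) * (#|noisy|%:R * (128 / d%:R) ^+ 2))).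
  rewrite ler_wpM2r ?mulr_ge0 ?sqr_ge0//.
  by rewrite (_ : 5 * d%:R = 4 * d%:R + d%:R) ?lerD2l//; ring.
by rewrite le_eqVlt; apply/orP; left; apply/eqP; field; rewrite gt_eqF.
Qed.

Let crossN (Q : pred 'I_n) (F : 'I_n -> R) :
  (forall k, Q k -> `|F k| <= 128 / d%:R * cross) ->
  `|\sum_(k | Q k) F k| <= 2^-1.
Proof.
move=> h; apply: le_trans (ler_norm_sum _ _ _) _.
apply: (@le_trans _ _ (\sum_(k | Q k) (128 / d%:R * cross))); first exact: ler_sum.
rewrite sumr_const.
apply: (@le_trans _ _ ((128 / d%:R * cross) *+ n)).
  apply: ler_wpMn2l; first by rewrite mulr_ge0 ?cross_ge0// divr_ge0.
  by rewrite -[X in (_ <= X)%N]card_ord max_card.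
rewrite -mulr_natl.
have -> : n%:R * (128 / d%:R * cross) = 2^-1 / m.+1%:R.
  by field; rewrite !gt_eqF.
by rewrite ler_pdivrMr// ler_peMr// ler1n.
Qed.

Lemma memo_other i j : j != pos i -> ~~ (noisy i && (j == sel i)) ->
  `|dotp memo (x i j)| <= 2^-1.
Proof.
move=> jp h; rewrite dotp_suml; apply: crossN => // k nk.
rewrite dotpZl normrM normrM s_abs mulr1 ger0_norm ?divr_ge0//.
rewrite ler_wpM2l ?divr_ge0//; apply: x_cross => //; first exact: sel_pos.
by apply: contra h => /eqP[ki <-]; rewrite -ki nk eqxx.
Qed.

(** At least 8 from the token's own summand, less at most 1/2 from all the others. *)
Lemma memo_sel i : noisy i -> 15 / 2 <= s i * dotp memo (x i (sel i)).
Proof.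
move=> ni; rewrite dotp_suml (bigD1 i)//= dotpZl mulrDr.
have h : `|\sum_(k | noisy k && (k != i))
    dotp ((128 / d%:R * s k) *: x k (sel k)) (x i (sel i))| <= 2^-1.
  apply: crossN => // k /andP[nk ki].
  rewrite dotpZl normrM normrM s_abs mulr1 ger0_norm ?divr_ge0//.
  rewrite ler_wpM2l ?divr_ge0//; apply: x_cross; rewrite ?sel_pos//.
  by rewrite xpair_eqE (negbTE ki).
set rest := \sum_(k | _) _ in h *.
have hs : s i * rest >= - 2^-1.
  rewrite lerNl; apply: le_trans h.
  by rewrite -[leRHS]mul1r -(s_abs i) -normrM -normrN ler_norm.
have -> : s i * (128 / d%:R * s i * dotp (x i (sel i)) (x i (sel i))) =
   128 / d%:R * dotp (x i (sel i)) (x i (sel i)).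
  by case: (s_sqr i) => ->; ring.
have /andP[lo _] := x_norm (sel_pos ni).
have : 8 <= 128 / d%:R * dotp (x i (sel i)) (x i (sel i)).
  by rewrite mulrAC ler_pdivlMr//; lra.
lra.
Qed.


Definition focus i := if noisy i then sel i else pos i.

End selection.

Definition with_signals (F : bool -> R) (u : 'cV[R]_d) : 'cV[R]_d :=
  F true *: mu1 + F false *: mu2 + u.

Section with_signals.
Context (F : bool -> R) (u : 'cV[R]_d).
Hypotheses (u1 : dotp mu1 u = 0) (u2 : dotp mu2 u = 0).

Lemma with_signals_norm : dotp (with_signals F u) (with_signals F u) =
  (F true ^+ 2 + F false ^+ 2) * rho ^+ 2 + dotp u u.
Proof.
rewrite /with_signals !dotpLin (dotpC u mu1) (dotpC u mu2) (dotpC mu2 mu1) u1 u2 mu12.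
by rewrite (dotp_mu1 mu1rho) (dotp_mu2 mu2rho); ring.
Qed.

Lemma with_signals_pos i : dotp (with_signals F u) (x i (pos i)) = F (b i) * rho ^+ 2.
Proof.
rewrite x_pos dotpC /with_signals; case: (b i); rewrite !dotpLin ?u1 ?u2.
  by rewrite mu12 (dotp_mu1 mu1rho); ring.
by rewrite (dotpC mu2 mu1) mu12 (dotp_mu2 mu2rho); ring.
Qed.

Lemma with_signals_noise i j : j != pos i ->
  dotp (with_signals F u) (x i j) = dotp u (x i j).
Proof.
by move=> /x_orth[h1 h2]; rewrite !dotpLin h1 h2 !mulr0 !add0r.
Qed.

End with_signals.

(** The score is 2 on signals, at least 15/2 on the selected tokens of noisy samples, and at most
    1/2 in absolute value on all other noise tokens. So the focused token wins by at least 1 on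
    clean and on noisy samples alike. *)
Definition query sel : 'cV[R]_d :=
  with_signals (fun=> 2 * rho ^- 2) (memo sel (fun=> 1)).

Let A : R := theta * (n%:R / d%:R).

Let A0 : 0 < A. Proof. by rewrite mulr_gt0// divr_gt0. Qed.

Let rho2 : 0 < rho ^+ 2. Proof. by rewrite exprn_gt0. Qed.

Section query.
Context (sel : 'I_n -> 'I_m.+1).
Hypothesis sel_pos : forall i, noisy i -> sel i != pos i.

Let one_sqr i : (fun=> 1 : R) i = 1 \/ (fun=> 1 : R) i = -1. Proof. by left. Qed.

Lemma query_norm : dotp (query sel) (query sel) <= A.
Proof.
have [h1 h2] := dotp_mu_memo (fun=> 1) sel_pos.
rewrite with_signals_norm//; apply: le_trans theta_ge.
apply: lerD; last exact: memo_norm.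
by rewrite le_eqVlt; apply/orP; left; apply/eqP; field; rewrite gt_eqF.
Qed.

Lemma query_gap i j : j != focus sel i ->
  dotp (query sel) (x i j) + 1 <= dotp (query sel) (x i (focus sel i)).
Proof.
have [h1 h2] := dotp_mu_memo (fun=> 1) sel_pos.
have posE : 2 * rho ^- 2 * rho ^+ 2 = 2 :> R by field; rewrite gt_eqF.
rewrite /focus; case: ifPn => ni jf.
  have := memo_sel sel_pos one_sqr ni; rewrite mul1r => hs.
  rewrite [leRHS]with_signals_noise ?sel_pos//.
  have [->|jp] := eqVneq j (pos i).
    by rewrite with_signals_pos// posE; lra.
  rewrite with_signals_noise//.
  have : `|dotp (memo sel (fun=> 1)) (x i j)| <= 2^-1.
    by apply: memo_other => //; rewrite ni.
  by rewrite ler_norml => /andP[_]; lra.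
rewrite with_signals_pos// posE with_signals_noise//.
have : `|dotp (memo sel (fun=> 1)) (x i j)| <= 2^-1.
  by apply: memo_other => //; rewrite (negbTE ni).
by rewrite ler_norml => /andP[_]; lra.
Qed.

End query.

Lemma feasibleE (g : R) v p : feasible S g v p <->
  forall i, 0 <= \sum_j expR (dotp p (x i j)) * (y i * dotp v (x i j) - g).
Proof. by split => h i; have := h i; rewrite (margin_geE _ _ _ _ _ ord0). Qed.

Lemma competitor_feasible sel (g L t B : R) v :
  (forall i, noisy i -> sel i != pos i) -> 0 <= g -> 0 <= B -> 0 < L ->
  (forall i, (1 + t) * g <= y i * dotp v (x i (focus sel i))) ->
  (forall i j, - (B * g) <= y i * dotp v (x i j)) ->
  m%:R * (B + 1) * expR (- L) <= t ->
  feasible S g v (L *: query sel).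
Proof.
move=> selp g0 B0 L0 hf hB ht; apply/feasibleE => i.
apply: (@margin_gap_ge0 _ _ _ _ _ (focus sel i) L t B) => // j jf.
rewrite !dotpZl -[X in _ + X <= _]mulr1 -mulrDr ler_pM2l//.
exact: query_gap.
Qed.

Lemma y_mul_pm1 i : y i * pm1 R (b i) = if noisy i then -1 else 1.
Proof.
by case: ifPn => [/y_noisy ->|/y_clean ->]; rewrite ?mulNr pm1_sqr.
Qed.

Lemma y_sqr i : y i * y i = 1.
Proof. by case: (y_pm1 i) => ->; ring. Qed.

Lemma pm1_exp2 c : pm1 R c ^+ 2 = 1.
Proof. by rewrite expr2 pm1_sqr. Qed.

Section crude.
Context (g L : R).
Hypotheses (g0 : 0 < g) (L0 : 0 < L) (gL : m%:R * 3 * expR (- L) <= 1).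

(** A competitor that presupposes nothing about the solution: focused tokens have value at least
    [2 * g], twice the margin, and no token has value below [- 2 * g]. *)
Definition crude sel : 'cV[R]_d :=
  g *: with_signals (fun c => 2 * rho ^- 2 * pm1 R c) (memo sel (fun i => y i)).

Lemma crude_norm sel : (forall i, noisy i -> sel i != pos i) ->
  dotp (crude sel) (crude sel) <= g ^+ 2 * A.
Proof.
move=> selp; have [h1 h2] := dotp_mu_memo (fun i => y i) selp.
rewrite dotpZl dotpZr mulrA -expr2 ler_pM2l ?exprn_gt0//.
rewrite with_signals_norm// !exprMn !pm1_exp2 !mulr1.
apply: le_trans theta_ge; apply: lerD; last exact: memo_norm.
by rewrite le_eqVlt; apply/orP; left; apply/eqP; field; rewrite gt_eqF.
Qed.

Lemma crude_feasible sel : (forall i, noisy i -> sel i != pos i) ->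
  feasible S g (crude sel) (L *: query sel).
Proof.
move=> selp; have [h1 h2] := dotp_mu_memo (fun i => y i) selp.
have posE c : 2 * rho ^- 2 * pm1 R c * rho ^+ 2 = 2 * pm1 R c.
  by field; rewrite gt_eqF.
apply: (@competitor_feasible _ _ _ 1 2) => //; first exact: ltW.
- move=> i; rewrite /focus /crude dotpZl; case: ifPn => ni.
    rewrite with_signals_noise ?selp//.
    have := memo_sel selp y_pm1 ni => hs.
    rewrite mulrCA mulrC ler_pM2l//; lra.
  rewrite with_signals_pos// posE mulrCA (mulrCA (y i)) y_mul_pm1 (negbTE ni).
  by rewrite mulr1 mulrC (_ : 1 + 1 = 2).
- move=> i j; rewrite dotpZl mulrCA -mulNr mulrC ler_pM2l//.
  have [->|jp] := eqVneq j (pos i).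
    rewrite with_signals_pos// posE mulrCA y_mul_pm1; case: ifP => _; lra.
  rewrite with_signals_noise//.
  have [/andP[ni /eqP ->]|other] := boolP (noisy i && (j == sel i)).
    by have := memo_sel selp y_pm1 ni; lra.
  have := memo_other selp y_pm1 jp other.
  by rewrite ler_norml => /andP[? ?]; case: (y_pm1 i) => ->; lra.
- by rewrite (_ : 2 + 1 = 3 :> R)//; ring.
Qed.


End crude.

Lemma dotp_mu_bound v : dotp v v =
  (dotp mu1 v / rho) ^+ 2 + (dotp mu2 v / rho) ^+ 2 + dotp (P *m v) (P *m v).
Proof. by rewrite (dotp_noise_cov rho0 mu12 mu1rho mu2rho); ring. Qed.

Section solution.
Context (g L : R) (v p : 'cV[R]_d).
(** [gE] gives [expR (- L) = g ^- 2]. [Lm] bounds the cost of the factor [1 + t] in [refined_bound]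
    by [L ^+ 2 * A], [Lm2] gives [t <= 1], and [Lrho] keeps the excess of a squared signal value
    below [g]. *)
Hypotheses (L1 : 1 <= L) (gE : g = expR (L / 2)) (Lg : L <= g).
Hypothesis Lm : 6 * (m%:R * (2 * n%:R + 3)) <= L ^+ 2.
Hypothesis Lm2 : m%:R * (2 * n%:R + 3) <= g ^+ 2.
Hypothesis Lrho : 2 * rho ^+ 2 * L ^+ 2 * A <= g.
Hypothesis vp_sol : is_solution S g v p.

Let g0 : 0 < g. Proof. by rewrite gE expR_gt0. Qed.
Let L0 : 0 < L. Proof. exact: lt_le_trans L1. Qed.
Let g2 : 0 < g ^+ 2. Proof. exact: exprn_gt0. Qed.
Let eL : expR (- L) = g ^- 2.
Proof. by rewrite gE expr2 -expRD -expRN; congr expR; field. Qed.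
Let feas i : 0 <= \sum_j expR (dotp p (x i j)) * (y i * dotp v (x i j) - g).
Proof. by have [/feasibleE] := vp_sol. Qed.

Let opt v' p' : feasible S g v' p' ->
  dotp p p + dotp v v <= dotp p' p' + dotp v' v'.
Proof. by have [_ h] := vp_sol => /h; rewrite !l2norm_sqr. Qed.

Let crude_bound : dotp p p + dotp v v <= 2 * g ^+ 2 * A.
Proof.
have [sel selp] : exists sel, forall i, sel i != pos i.
  by exists (fun i => projT1 (cid (exists_noise i))) => i; case: cid.
have selp' i : noisy i -> sel i != pos i by [].
have f : feasible S g (crude g sel) (L *: query sel).
  apply: crude_feasible => //.
  rewrite eL ler_pdivrMr// mul1r; apply: le_trans Lm2.
  rewrite ler_wpM2l//; have := np; lra.
apply: le_trans (opt f) _.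
have h1 := crude_norm g0 selp'; have h2 := query_norm selp'.
have h3 : dotp (L *: query sel) (L *: query sel) <= g ^+ 2 * A.
  rewrite dotpZl dotpZr mulrA -expr2; apply: ler_pM => //.
  - exact: sqr_ge0.
  - exact: dotp_ge0.
  - by rewrite ler_pXn2r// nnegrE ltW.
lra.
Qed.

Let v_norm : dotp v v <= 2 * g ^+ 2 * A.
Proof. by have := crude_bound; have := dotp_ge0 p; lra. Qed.

Let dA : d%:R * A = theta * n%:R.
Proof. by rewrite /A; field; rewrite gt_eqF. Qed.

(** Otherwise every clean sample of class [c] relies on a noise token of value [g], and
    [clean_class_le] with weight [g ^- 2] on [v] gives [n / 8 <= 10 * theta * n]. *)
Lemma solution_signal c : g <= pm1 R c * dotp (mu c) v.
Proof.
rewrite leNgt; apply/negP => h.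
have := @clean_class_le c v 0 (g ^- 2) 0.
rewrite dotp0l mulr0 addr0 => /(_ _ _ (lexx 0)) h'.
have : n%:R / 8 <= 5 * d%:R * (g ^- 2 * dotp v v) :> R.
  apply: h'; last by rewrite invr_ge0 sqr_ge0.
  move=> i bc cl; have [j hj] := margin_ge0_exists (feas i).
  have jp : j != pos i.
    apply: contraTneq hj => ->; rewrite -ltNge x_pos bc dotpC y_clean// bc.
    exact: h.
  exists j => //; rewrite dotp0l expr0n/= mulr0 addr0.
  rewrite mulrC ler_pdivlMr// mul1r.
  have -> : dotp v (x i j) ^+ 2 = (y i * dotp v (x i j)) ^+ 2.
    by rewrite exprMn [y i ^+ 2]expr2 y_sqr mul1r.
  by rewrite ler_pXn2r// nnegrE ltW// (lt_le_trans g0).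
apply/negP; rewrite -ltNge.
apply: (@le_lt_trans _ _ (5 * d%:R * (2 * A))).
  rewrite ler_pM2l ?mulr_gt0// mulrC ler_pdivrMr//.
  by rewrite mulrAC.
have -> : 5 * d%:R * (2 * A) = 10 * (d%:R * A) by ring.
rewrite dA; have := theta_small; have := np; nra.
Qed.

Let signal_sqr c : g ^+ 2 / rho ^+ 2 <= (dotp (mu c) v / rho) ^+ 2.
Proof.
rewrite expr_div_n ler_pM2r ?invr_gt0//.
have h := solution_signal c; have h0 := le_trans (ltW g0) h.
by rewrite -[leRHS]mul1r -(pm1_exp2 c) -exprMn ler_pXn2r// nnegrE ltW.
Qed.

Lemma noisy_sel : exists sel, forall i, noisy i ->
  sel i != pos i /\ g <= y i * dotp v (x i (sel i)).
Proof.
suff h i : exists j, noisy i -> j != pos i /\ g <= y i * dotp v (x i j).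
  by exists (fun i => projT1 (cid (h i))) => i; case: cid.
have [ni|cl] := boolP (noisy i); last by exists ord0.
have [j hj] := margin_ge0_exists (feas i).
exists j => _; split => //; apply: contraTneq hj => ->; rewrite -ltNge.
rewrite x_pos dotpC y_noisy// mulNr.
have := solution_signal (b i); have := g0; lra.
Qed.

Let n1 : 1 <= n%:R :> R. Proof. by rewrite ler1n. Qed.

(** A rough bound suffices: it enters only through the [B] of [competitor_feasible], which is
    multiplied by [expR (- L) = g ^- 2]. *)
Let noise_value i j : j != pos i -> `|dotp v (x i j)| <= n%:R * g.
Proof.
move=> jp; rewrite -(@ler_pXn2r _ 2)// ?nnegrE ?mulr_ge0//; last exact: ltW.
rewrite real_normK ?num_real//; apply: le_trans (cauchy_schwarz _ _) _.
have /andP[_ xn] := x_norm jp.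
apply: (@le_trans _ _ (2 * g ^+ 2 * A * (4 * d%:R))).
  by apply: ler_pM => //; exact: dotp_ge0.
have -> : 2 * g ^+ 2 * A * (4 * d%:R) = 8 * theta * n%:R * g ^+ 2.
  by transitivity (8 * g ^+ 2 * (d%:R * A)); [ring|rewrite dA; ring].
rewrite exprMn ler_pM2r//; have := theta_small; have := n1; nra.
Qed.

(* Lowering both signal components of [v] to the margin and replacing [p] by
   a multiple of a query that separates the tokens already selected by [v]
   cannot be an improvement. *)
Let refined_bound :
  (dotp mu1 v / rho) ^+ 2 + (dotp mu2 v / rho) ^+ 2 + dotp p p <=
  2 * g ^+ 2 / rho ^+ 2 + 2 * L ^+ 2 * A.
Proof.
have [sel hsel] := noisy_sel.
have selp i : noisy i -> sel i != pos i by move=> /hsel[].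
(* The least [t] allowed by [competitor_feasible] for [B = 2 * n + 2]. *)
pose t := m%:R * (2 * n%:R + 3) / g ^+ 2.
have t0 : 0 <= t.
  by rewrite divr_ge0 ?(ltW g2)// mulr_ge0//; have := np; lra.
have t1 : t <= 1 by rewrite ler_pdivrMr// mul1r.
have Pv1 := dotp_mu1_noise rho0 mu12 mu1rho v.
have Pv2 := dotp_mu2_noise rho0 mu12 mu2rho v.
(* Keeping the projection of [v] leaves all noise values unchanged, so the noise tokens already
   selected by [v] still reach the margin. *)
pose w := with_signals (fun c => g * rho ^- 2 * pm1 R c) (P *m v).
have posE c : g * rho ^- 2 * pm1 R c * rho ^+ 2 = g * pm1 R c.
  by field; rewrite gt_eqF.
have wnoise i j : j != pos i -> dotp w (x i j) = dotp v (x i j).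
  move=> jp; rewrite with_signals_noise//.
  have [h1 h2] := x_orth jp.
  by rewrite dotpC dotp_mulmxr noise_cov_tr noise_cov_id// dotpC.
have f : feasible S g ((1 + t) *: w) (L *: query sel).
  apply: (@competitor_feasible _ _ _ t (2 * n%:R + 2)) => //.
  - exact: ltW.
  - move=> i; rewrite dotpZl mulrCA; apply: ler_wpM2l; first by lra.
    rewrite /focus; case: ifPn => ni; first by have [h1 h2] := hsel i ni; rewrite wnoise.
    by rewrite with_signals_pos// posE mulrCA y_mul_pm1 (negbTE ni) mulr1.
  - move=> i j; rewrite dotpZl mulrCA.
    have : - (n%:R * g) <= y i * dotp w (x i j).
      have gn : g <= n%:R * g by rewrite ler_peMl// ltW.
      have [->|jp] := eqVneq j (pos i).
        by rewrite with_signals_pos// posE mulrCA y_mul_pm1; have := g0; case: ifP => _; lra.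
      rewrite wnoise//; have := noise_value jp; rewrite ler_norml => /andP[? ?].
      by case: (y_pm1 i) => ->; lra.
    have := mulr_gt0 np g0; have := g0; nra.
  - rewrite /t eL (_ : 2 * n%:R + 2 + 1 = 2 * n%:R + 3)//; ring.
have op := opt f.
have wn : dotp w w = 2 * g ^+ 2 / rho ^+ 2 + dotp (P *m v) (P *m v).
  rewrite with_signals_norm// !exprMn !pm1_exp2; congr (_ + _).
  by field; rewrite gt_eqF.
have vE := dotp_mu_bound v.
have wv : dotp w w <= 2 * g ^+ 2 * A.
  apply: le_trans v_norm; rewrite wn vE lerD2r.
  by have := signal_sqr true; have := signal_sqr false; rewrite /=; lra.
rewrite !dotpZl !dotpZr !mulrA -!expr2 in op.
have qn : L ^+ 2 * dotp (query sel) (query sel) <= L ^+ 2 * A.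
  by rewrite ler_pM2l ?exprn_gt0// query_norm.
(* [(1 + t) ^ 2 - 1 <= 3 * t] as [t <= 1], and the [g ^ 2] in the norm of [w] cancels the one in the
   denominator of [t]. *)
have tw : ((1 + t) ^+ 2 - 1) * dotp w w <= L ^+ 2 * A.
  apply: (@le_trans _ _ (3 * t * (2 * g ^+ 2 * A))).
    apply: ler_pM => //; [nra|exact: dotp_ge0|nra].
  have -> : 3 * t * (2 * g ^+ 2 * A) = 6 * (m%:R * (2 * n%:R + 3)) * A.
    by rewrite /t; field; rewrite gt_eqF.
  by rewrite ler_wpM2r// ltW.
rewrite vE in op; move: wn; lra.
Qed.

Let p_norm : dotp p p <= 2 * L ^+ 2 * A.
Proof.
have := refined_bound; have := signal_sqr true; have := signal_sqr false; rewrite /=; lra.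
Qed.

(** Subtracting from [refined_bound] the lower bound on the other signal leaves a squared value of
    at most [g ^ 2 + g], which is below [(g + 1 / 2) ^ 2]. *)
Let signal_excess c : pm1 R c * dotp (mu c) v - g <= 2^-1.
Proof.
have h : (dotp (mu c) v / rho) ^+ 2 <= g ^+ 2 / rho ^+ 2 + 2 * L ^+ 2 * A.
  have := refined_bound; have := signal_sqr true; have := signal_sqr false.
  have := dotp_ge0 p; case: c; rewrite /=; lra.
have : (pm1 R c * dotp (mu c) v) ^+ 2 <= g ^+ 2 + g.
  rewrite exprMn pm1_exp2 mul1r.
  have := ler_wpM2r (ltW rho2) h.
  rewrite expr_div_n divfK ?gt_eqF// mulrDl divfK ?gt_eqF//.
  by move=> /le_trans; apply; rewrite lerD2l; apply: le_trans Lrho; rewrite le_eqVlt;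
    apply/orP; left; apply/eqP; ring.
by have := solution_signal c; have := g0; nra.
Qed.

(** Suppose the signal score is below [L / 4]. On a clean sample of the class, either a noise token
    has value at least [g / 2], which is charged to [v], or the gap of [L / 2] pushes a noise score
    below [- L / 4], which is charged to [p]. The weights [4 / g ^ 2] and [16 / L ^ 2] make each
    charge at least 1, and the total is at most [200 * theta * n < n / 8]. *)
Lemma solution_query c : L / 4 <= dotp (mu c) p.
Proof.
rewrite leNgt; apply/negP => h.
have g2n : g ^+ 2 != 0 by rewrite gt_eqF.
have L2 : 0 < L ^+ 2 by rewrite exprn_gt0.
have L2n : L ^+ 2 != 0 by rewrite gt_eqF.
have : n%:R / 8 <= 5 * d%:R * (4 / g ^+ 2 * dotp v v + 16 / L ^+ 2 * dotp p p) :> R.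
  apply: (@clean_class_le c); [|by rewrite divr_ge0// ltW..].
  move=> i bc cl.
  have [[j [jp hj]]|nbig] := pselect (exists j, j != pos i /\ g / 2 <= y i * dotp v (x i j)).
    exists j => //; rewrite -[leLHS]addr0; apply: lerD; last first.
      by rewrite mulr_ge0 ?sqr_ge0// divr_ge0// ltW.
    have hj2 : (g / 2) ^+ 2 <= dotp v (x i j) ^+ 2.
      have -> : dotp v (x i j) ^+ 2 = (y i * dotp v (x i j)) ^+ 2.
        by rewrite exprMn [y i ^+ 2]expr2 y_sqr mul1r.
      by rewrite ler_pXn2r ?nnegrE// ?divr_ge0 ?(ltW g0)// (le_trans _ hj)// divr_ge0// ltW.
    by rewrite mulrAC ler_pdivlMr//; lra.
  have [j jp] := exists_noise i; exists j => //.
  rewrite -[leLHS]add0r; apply: lerD.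
    by rewrite mulr_ge0 ?sqr_ge0// divr_ge0// ltW.
  have := margin_ge0_score (ltW g0) (feas i) jp.
  have small k : k != pos i -> y i * dotp v (x i k) <= g / 2.
    by move=> kp; rewrite leNgt; apply/negP => /ltW hk; apply: nbig; exists k.
  move=> /(_ small); rewrite x_pos bc (y_clean cl) bc (dotpC v) (dotpC p (if c then _ else _)).
  set cp := dotp (mu c) p in h *; set e := dotp p _.
  move=> he.
  have {he} : expR (e + L / 2) <= expR cp.
    rewrite expRD -gE.
    have := ler_wpM2l (expR_ge0 cp) (signal_excess c); lra.
  rewrite ler_expR => he.
  have : (L / 4) ^+ 2 <= e ^+ 2 by have := L0; nra.
  rewrite mulrAC ler_pdivlMr//; lra.
apply/negP; rewrite -ltNge.
apply: (@le_lt_trans _ _ (5 * d%:R * (4 * (2 * A) + 16 * (2 * A)))).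
  rewrite ler_pM2l ?mulr_gt0//; apply: lerD.
    by rewrite mulrAC ler_pdivrMr//; have := v_norm; lra.
  by rewrite mulrAC ler_pdivrMr//; have := p_norm; lra.
have -> : 5 * d%:R * (4 * (2 * A) + 16 * (2 * A)) = 200 * (d%:R * A) by ring.
rewrite dA; have := theta_small; have := np; nra.
Qed.

Lemma solution_norms :
  dotp v v <= 2 * g ^+ 2 * A /\ dotp p p <= 2 * L ^+ 2 * A.
Proof. by split; [exact: v_norm|exact: p_norm]. Qed.

End solution.
Lemma training_conclusion (g L : R) :
  1 <= L -> g = expR (L / 2) -> L <= g ->
  6 * (m%:R * (2 * n%:R + 3)) <= L ^+ 2 -> m%:R * (2 * n%:R + 3) <= g ^+ 2 ->
  2 * rho ^+ 2 * L ^+ 2 * A <= g ->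
  (exists v p, feasible S g v p) /\
  forall v p, is_solution S g v p ->
    [/\ forall c, g <= pm1 R c * dotp (mu c) v,
        forall c, L / 4 <= dotp (mu c) p,
        dotp v v <= 2 * g ^+ 2 * A &
        dotp p p <= 2 * L ^+ 2 * A].
Proof.
move=> L1 gE Lg Lm Lm2 Lrho; split.
  pose sel i := projT1 (cid (exists_noise i)).
  have selp i : sel i != pos i by rewrite /sel; case: cid.
  have g0 : 0 < g by rewrite gE expR_gt0.
  exists (crude g sel), (L *: query sel); apply: crude_feasible => //.
    exact: lt_le_trans L1.
  have -> : expR (- L) = g ^- 2.
    by rewrite gE expr2 -expRD -expRN; congr expR; field.
  rewrite ler_pdivrMr ?exprn_gt0// mul1r; apply: le_trans Lm2.
  by rewrite ler_wpM2l//; have := np; lra.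
move=> v p sol; have [h1 h2] := solution_norms L1 gE Lg Lm Lm2 sol.
split => // c; [exact: (solution_signal L1 gE Lg Lm2 sol)|
  exact: (solution_query L1 gE Lg Lm Lm2 Lrho sol)].
Qed.

End training_set.

(** * Existence of a minimizer *)

Section continuity.
Context (R : realType) (T : topologicalType).

Lemma continuous_sum (I : Type) (r : seq I) (F : I -> T -> R) :
  (forall i, continuous (F i)) -> continuous (fun x => \sum_(i <- r) F i x).
Proof.
move=> cF; elim: r => [|i r IH] x.
  by under eq_fun do rewrite big_nil; exact: cvg_cst.
under eq_fun do rewrite big_cons.
by apply: cvgD; [exact: cF|exact: IH].
Qed.

Lemma continuous_mul (f g : T -> R) :
  continuous f -> continuous g -> continuous (fun x => f x * g x).
Proof. by move=> cf cg x; apply: cvgM; [exact: cf|exact: cg]. Qed.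

Lemma continuous_add (f g : T -> R) :
  continuous f -> continuous g -> continuous (fun x => f x + g x).
Proof. by move=> cf cg x; apply: cvgD; [exact: cf|exact: cg]. Qed.

Lemma continuous_expR_comp (f : T -> R) :
  continuous f -> continuous (fun x => expR (f x)).
Proof. by move=> cf x; apply: continuous_comp; [exact: cf|exact: continuous_expR]. Qed.

Lemma continuous_dotp d (f g : T -> 'cV[R]_d) :
  (forall i, continuous (fun x => f x i 0)) ->
  (forall i, continuous (fun x => g x i 0)) ->
  continuous (fun x => dotp (f x) (g x)).
Proof.
move=> cf cg; under eq_fun do rewrite dotpE.
by apply: continuous_sum => i; exact: continuous_mul.
Qed.

Lemma closed_ge_fun (f : T -> R) (s : R) :
  continuous f -> closed [set x | s <= f x].
Proof. move=> cf; exact: ((continuous_closedP f).1 cf _ (@closed_ge R s)). Qed.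

Lemma closed_le_fun (f : T -> R) (s : R) :
  continuous f -> closed [set x | f x <= s].
Proof. move=> cf; exact: ((continuous_closedP f).1 cf _ (@closed_le R s)). Qed.

End continuity.

Section existence.
Context (R : realType) (T d n : nat) (S : n.-tuple ('M[R]_(T.+1, d) * R)) (g : R).
Local Notation x i j := (token (tnth S i).1 j).
Local Notation y i := (tnth S i).2.

(** The pair is coded as one row vector, so that bounded closed sets of pairs are compact by
    [bounded_closed_compact]. *)
Definition pair_v (z : 'rV[R]_(d + d)) : 'cV[R]_d := (lsubmx z)^T.
Definition pair_p (z : 'rV[R]_(d + d)) : 'cV[R]_d := (rsubmx z)^T.

Lemma pair_vK v p : pair_v (row_mx v^T p^T) = v.
Proof. by rewrite /pair_v row_mxKl trmxK. Qed.

Lemma pair_pK v p : pair_p (row_mx v^T p^T) = p.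
Proof. by rewrite /pair_p row_mxKr trmxK. Qed.

Definition pair_cost z := dotp (pair_v z) (pair_v z) + dotp (pair_p z) (pair_p z).

Lemma pair_costE z : pair_cost z = \sum_k z 0 k ^+ 2.
Proof.
rewrite /pair_cost !dotpE big_split_ord/=.
by congr (_ + _); apply: eq_bigr => i _; rewrite !mxE expr2.
Qed.

Lemma continuous_pair_v i : continuous (fun z => pair_v z i 0).
Proof. by under eq_fun do rewrite !mxE; exact: coord_continuous. Qed.

Lemma continuous_pair_p i : continuous (fun z => pair_p z i 0).
Proof. by under eq_fun do rewrite !mxE; exact: coord_continuous. Qed.

Lemma continuous_pair_cost : continuous pair_cost.
Proof.
apply: continuous_add.
  exact: (continuous_dotp continuous_pair_v continuous_pair_v).
exact: (continuous_dotp continuous_pair_p continuous_pair_p).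
Qed.

Lemma closed_feasible : closed [set z | feasible S g (pair_v z) (pair_p z)].
Proof.
rewrite (_ : mkset _ = \bigcap_(i in [set: 'I_n]) [set z | 0 <= \sum_j
    expR (dotp (pair_p z) (x i j)) * (y i * dotp (pair_v z) (x i j) - g)]); last first.
  apply/seteqP; split => z /= h i; have := h i.
    by rewrite (margin_geE _ _ _ _ _ ord0).
  by rewrite (margin_geE _ _ _ _ _ ord0); apply.
apply: closed_bigI => i _; apply: closed_ge_fun; apply: continuous_sum => j.
have cst (k : 'I_d) : continuous (fun _ : 'rV[R]_(d + d) => x i j k 0) by apply: cst_continuous.
apply: continuous_mul.
  apply: continuous_expR_comp.
  exact: (continuous_dotp continuous_pair_p cst).
apply: (@continuous_add _ _ (fun z => y i * dotp (pair_v z) (x i j))).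
  apply: (@continuous_mul _ _ (fun=> y i)); first by apply: cst_continuous.
  exact: (continuous_dotp continuous_pair_v cst).
by apply: cst_continuous.
Qed.

Lemma solution_exists v0 p0 : feasible S g v0 p0 ->
  exists v p, is_solution S g v p.
Proof.
move=> f0; pose z0 := row_mx v0^T p0^T.
pose A := [set z | feasible S g (pair_v z) (pair_p z)] `&`
          [set z | pair_cost z <= pair_cost z0].
have Az0 : A z0 by split; rewrite /= ?pair_vK ?pair_pK.
have cA : compact A.
  apply: bounded_closed_compact; last first.
    by apply: closedI; [exact: closed_feasible|exact/closed_le_fun/continuous_pair_cost].
  (* The summand 1 gives [M >= 1], so that a bound [M] on the square of an entry is also a bound on
     the entry. *)
  exists (1 + pair_cost z0); split; first exact: num_real.
  move=> M hM z [_ /= hz]; rewrite [leLHS]mx_normrE.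
  have M1 : 1 <= M.
    apply: le_trans (ltW hM); rewrite lerDl pair_costE.
    by apply: sumr_ge0 => k _; exact: sqr_ge0.
  apply/bigmax_leP; split; first exact: le_trans M1.
  move=> [i k] _ /=; rewrite ord1.
  have zk : `|z 0 k| ^+ 2 <= M.
    apply: (@le_trans _ _ (pair_cost z)).
      rewrite pair_costE (bigD1 k)//= real_normK ?num_real// lerDl.
      by apply: sumr_ge0 => l _; exact: sqr_ge0.
    by apply: le_trans hz _; apply: le_trans (ltW hM); rewrite lerDr.
  have := normr_ge0 (z 0 k); nra.
have [z /set_mem[fz hz] zmin] : exists2 c, c \in A & forall t, t \in A ->
    pair_cost c <= pair_cost t.
  apply: compact_EVT_min => //; first by exists z0.
  exact/continuous_subspaceT/continuous_pair_cost.
exists (pair_v z), (pair_p z); split => // v' p' f'.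
rewrite !l2norm_sqr addrC [leRHS]addrC.
pose z' := row_mx v'^T p'^T.
have cz' : pair_cost z' = dotp v' v' + dotp p' p'.
  by rewrite /pair_cost pair_vK pair_pK.
rewrite -cz' -/(pair_cost z).
have [h|/ltW h] := leP (pair_cost z') (pair_cost z0).
  by apply: zmin; apply/mem_set; split; rewrite /= ?pair_vK ?pair_pK.
exact: le_trans hz h.
Qed.

End existence.

(** * The data distribution *)

Section count_tail.
Context (R : realType) d (T : measurableType d) (P : probability T R).

Lemma ln2_ge : 2^-1 <= ln 2 :> R.
Proof.
rewrite -ler_expR lnK ?posrE//.
have := @expR_ge1Dx R (- 2^-1); rewrite expRN => h.
rewrite -[leRHS]invrK -[leLHS]invrK lef_pV2 ?posrE ?invr_gt0 ?expR_gt0//; lra.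
Qed.

(** The Chernoff parameter [ln 2] gives [expR (ln 2 * \1_A) = 1 + \1_A], whose mean is at most
    [1 + q]. *)
Lemma iid_count_tail n (A : set T) (q k : R) : measurable A -> (P A <= q%:E)%E ->
  (iid_prob P n [set t | (k <= \sum_i \1_A (tnth t i))%R] <=
     ((1 + q) ^+ n * expR (- (ln 2 * k)))%:E)%E.
Proof.
move=> mA PA.
have l2 : 0 < ln 2 :> R by have := ln2_ge; lra.
have -> : [set t : n.-tuple T | (k <= \sum_i \1_A (tnth t i))%R] =
    [set t | (ln 2 * k <= \sum_i ln 2 * \1_A (tnth t i))%R].
  by apply/seteqP; split => t /=; rewrite -mulr_sumr ler_pM2l.
apply: le_trans (iid_chernoff (g := fun _ x => ln 2 * \1_A x)
  (M := fun=> 1 + q) _ _ _) _ => [i|i|].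
- by apply: measurable_funM => //; exact: measurable_indic.
- under eq_integral => x _.
    rewrite (_ : expR _ = 1 + \1_A x); last first.
      by rewrite indicE; case: (x \in A); rewrite ?mulr1 ?mulr0 ?expR0 ?addr0// lnK ?posrE.
    rewrite EFinD.
    over.
  rewrite ge0_integralD//; last first.
  + by apply/measurable_EFinP; exact: measurable_indic.
  rewrite (integral_cst P measurableT 1%:E) (integral_indic P measurableT mA) setIT EFinD.
  apply: leeD => //; have := probability_setT P.
  by rewrite /= => ->; rewrite mule1.
- by rewrite prodr_const card_ord.
Qed.

End count_tail.

Section tokens.
Context (R : realType) (d m : nat).

Lemma token_clean_pos (u : 'cV[R]_d) (pos : 'I_m.+1) xi :
  token (clean_tokens u pos xi) pos = u.
Proof.
apply/matrixP => k j; rewrite !mxE ord1.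
by case: unliftP (@unlift_none _ pos) => // ? ->.
Qed.

Lemma token_clean_lift (u : 'cV[R]_d) (pos : 'I_m.+1) xi s :
  token (clean_tokens u pos xi) (lift pos s) = tnth xi s.
Proof. by apply/matrixP => k j; rewrite !mxE ord1 liftK. Qed.

Lemma measurable_token d' (T' : measurableType d') n (f : T' -> 'M[R]_(n, d)) j :
  measurable_fun setT f -> measurable_fun setT (fun x => token (f x) j).
Proof.
move=> /measurable_fun_mxP mf; apply/measurable_fun_mxP => k l.
by under eq_fun do rewrite !mxE; exact: mf.
Qed.

End tokens.

Lemma bernoulli_prob_set1 (R : realType) (p : R) (b : bool) : 0 <= p <= 1 ->
  (bernoulli_prob p : probability bool R) [set b] = (if b then p else 1 - p)%:E.
Proof.
move=> p01; transitivity (bernoulli_prob p [set b]); first by [].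
rewrite bernoulli_probE// !diracE !in_set1.
by case: b; rewrite !(mule0, mule1, adde0, add0e).
Qed.

Section data_law.
Context (R : realType) (d m : nat) (rho eta : R) (mu1 mu2 : 'cV[R]_d).
Hypotheses (eta0 : 0 <= eta) (eta1 : eta <= 1).
Local Notation mu := (fun c : bool => if c then mu1 else mu2).
Local Notation N := (gaussian (noise_cov rho mu1 mu2)).
Local Notation sample := ('M[R]_(m.+1, d) * R)%type.
Local Notation Dc := (D_clean m rho mu1 mu2).
Local Notation Dn := (D_noisy m rho mu1 mu2 eta).
Implicit Types A : set sample.

Lemma D_cleanE A : Dc A =
  prod_prob (prod_prob (bernoulli_prob (2^-1 : R)) (uniform_ord R m)) (iid_prob N m)
    [set w | A (clean_sample mu1 mu2 w)].
Proof. by []. Qed.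

Lemma D_noisyE A : Dn A =
  prod_prob Dc (bernoulli_prob eta) [set w | A (flip_label w)].
Proof. by []. Qed.

Lemma D_clean_le A (q : R) : measurable A -> 0 <= q ->
  (forall c pos, (iid_prob N m
     [set xi | A (clean_tokens (mu c) pos xi, pm1 R c)] <= q%:E)%E) ->
  (Dc A <= q%:E)%E.
Proof.
move=> mA q0 h; rewrite D_cleanE; apply: prod_prob_le_sup => //.
  by apply: measurable_preimage mA; exact: measurable_clean_sample.
by move=> [c pos]; exact: h.
Qed.

Lemma D_clean_class_le A c0 : measurable A ->
  (forall pos, (iid_prob N m
     [set xi | A (clean_tokens (mu c0) pos xi, pm1 R c0)] <= 0)%E) ->
  (Dc A <= (2^-1)%:E)%E.
Proof.
move=> mA h; rewrite D_cleanE -[X in (_ <= X%:E)%E]addr0.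
apply: (@prod_prob_le _ _ _ _ _ _ _ _ [set w | w.1 = ~~ c0]) => //.
- by apply: measurable_preimage mA; exact: measurable_clean_sample.
- by apply: (measurable_preimage (A := [set ~~ c0])) => //; exact: measurable_fst.
- rewrite -[X in (_ <= X%:E)%E]addr0; apply: (@prod_prob_le _ _ _ _ _ _ _ _ [set ~~ c0]) => //.
  + by apply: (measurable_preimage (A := [set ~~ c0])) => //; exact: measurable_fst.
  + have half01 : 0 <= (2^-1 : R) <= 1 by apply/andP; split; lra.
    rewrite bernoulli_prob_set1//.
    by case: (~~ c0) => //; rewrite lee_fin; lra.
  + move=> c cc; rewrite (_ : [set _ | _] = set0) ?measure0//.
    by rewrite -subset0 => pos /=.
- move=> [c pos] /= cc; have -> : c = c0 by case: c c0 cc {h} => [] [].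
  exact: h.
Qed.

(** Allowing both labels loses nothing for events that do not distinguish a label from its negation.
    For the other events, [D_noisy_flip_le] pays [eta] for the flip. *)
Lemma D_noisy_le A (q : R) : measurable A ->
  (Dc [set s | A s \/ A (s.1, (- s.2)%R)] <= q%:E)%E -> (Dn A <= q%:E)%E.
Proof.
move=> mA h; rewrite D_noisyE -[q]addr0.
have mF : measurable_fun setT (fun s : sample => (s.1, - s.2)).
  apply/measurable_fun_pairP; split; first exact: measurable_fst.
  exact: measurableT_comp (@oppr_measurable R setT) measurable_snd.
apply: (@prod_prob_le _ _ _ _ _ _ _ _ [set s | A s \/ A (s.1, - s.2)]) => //.
- by apply: measurable_preimage mA; exact: measurable_flip_label.
- by apply: measurableU => //; exact: (measurable_preimage mF).
- move=> [X y] /= nA; rewrite (_ : [set _ | _] = set0) ?measure0//.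
  rewrite -subset0 => -[|] /=; rewrite /flip_label/= => a; apply: nA.
    by right.
  by left.
Qed.

Lemma D_noisy_flip_le A (q : R) : measurable A ->
  (Dc A <= q%:E)%E -> (Dn A <= (eta + q)%:E)%E.
Proof.
move=> mA h; rewrite D_noisyE.
have mb : measurable [set w : sample * bool | w.2 = true].
  by apply: (measurable_preimage (A := [set true])) => //; exact: measurable_snd.
have mA1 : measurable [set w : sample * bool | A w.1].
  by apply: measurable_preimage mA; exact: measurable_fst.
apply: (@prob_le _ _ _ _ _ ([set w | w.2 = true] `|` [set w | A w.1])).
- by apply: measurable_preimage mA; exact: measurable_flip_label.
- exact: measurableU.
- by move=> [[X y] [|]] /=; [left|right].
- apply: prob_setU_le => //.
    apply: prod_prob_le_sup => // s.
    rewrite (_ : [set _ | _] = [set true]); last by apply/seteqP; split=> b /=.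
    by rewrite bernoulli_prob_set1 ?eta0 ?eta1 ?lexx.
  rewrite -[q]addr0; apply: (@prod_prob_le _ _ _ _ _ _ _ _ A) => //.
  move=> s nA; rewrite (_ : [set _ | _] = set0) ?measure0//.
  by rewrite -subset0 => b /=.
Qed.

End data_law.

Section measurable_conditions.
Context d (T : measurableType d).

Lemma measurable_forall (I : finType) (A : I -> set T) :
  (forall i, measurable (A i)) -> measurable [set t | forall i, A i t].
Proof.
move=> mA; rewrite (_ : mkset _ = \bigcap_(i in [set: I]) A i).
  by apply: fin_bigcap_measurable => //; exact: finite_finset.
by apply/seteqP; split => t /= h i; [move=> _|]; exact: h.
Qed.

Lemma measurable_imply (b : bool) (A : set T) :
  measurable A -> measurable [set t | b -> A t].
Proof.
case: b => mA; last by rewrite (_ : mkset _ = setT)//; apply/seteqP.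
by rewrite (_ : mkset _ = A)//; apply/seteqP; split => t /=; [apply|].
Qed.

Lemma measurable_eq_cst (R : realType) (f : T -> R) c :
  measurable_fun setT f -> measurable [set t | f t = c].
Proof.
move=> mf; apply: (measurable_preimage (A := [set c])) => //.
Qed.

End measurable_conditions.

(** * Events for one sample and for a pair of samples *)

Section events.
Context (R : realType) (d m : nat) (rho eta t : R) (mu1 mu2 : 'cV[R]_d).
Hypotheses (eta0 : 0 <= eta) (eta1 : eta <= 1) (t0 : 0 < t) (d0 : (0 < d)%N).
Hypotheses (rho0 : 0 < rho) (mu12 : dotp mu1 mu2 = 0)
  (mu1rho : l2norm mu1 = rho) (mu2rho : l2norm mu2 = rho).
Local Notation mu := (fun c : bool => if c then mu1 else mu2).
Local Notation P := (noise_cov rho mu1 mu2).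
Local Notation N := (gaussian P).
Local Notation sample := ('M[R]_(m.+1, d) * R)%type.
Local Notation Dc := (D_clean m rho mu1 mu2).
Local Notation Dn := (D_noisy m rho mu1 mu2 eta).
Local Notation E := (expR (- (t ^+ 2 / (2 * (4 * d%:R)))) : R).
Implicit Types (x : 'cV[R]_d) (X : 'M[R]_(m.+1, d)) (s : sample).

Let dp : 0 < d%:R :> R. Proof. by rewrite ltr0n. Qed.

Definition not_orth : set 'cV[R]_d :=
  ~` ([set x | dotp mu1 x = 0] `&` [set x | dotp mu2 x = 0]).

Lemma measurable_not_orth : measurable not_orth.
Proof.
by apply: measurableC; apply: measurableI; apply: measurable_eq_cst;
  exact: measurable_dotpr.
Qed.

Lemma noise_not_orth : (N not_orth <= 0)%E.
Proof.
rewrite gaussianE (_ : [set z | _] = set0) ?measure0//.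
rewrite -subset0 => z /=; apply.
by split => /=; [exact: dotp_mu1_noise|exact: dotp_mu2_noise].
Qed.

Definition bad_token : set 'cV[R]_d := @bad_norm R d `|` not_orth.

Lemma measurable_bad_token : measurable bad_token.
Proof.
by apply: measurableU; [exact: measurable_bad_norm|exact: measurable_not_orth].
Qed.

Lemma noise_bad_token_le : (N bad_token <= (6 * expR (- (d%:R / 64)))%:E)%E.
Proof.
rewrite -[X in X%:E]addr0; apply: prob_setU_le.
- exact: measurable_bad_norm.
- exact: measurable_not_orth.
- exact: noise_bad_norm_le.
- exact: noise_not_orth.
Qed.

(** Reads the clean label off the tokens: the signal contributes [rho ^+ 2] or its opposite, and
    orthogonal noise contributes 0. A sample does not record its clean label, and this makes the
    class and the label flip measurable events of the sample. *)
Definition label X : R := (\sum_j dotp (mu1 - mu2) (token X j)) / rho ^+ 2.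

Lemma labelE c pos X : token X pos = mu c ->
  (forall j, j != pos -> ~ not_orth (token X j)) -> label X = pm1 R c.
Proof.
move=> hpos horth; rewrite /label (bigD1 pos)//= big1 ?addr0.
  rewrite hpos; case: c {hpos}; rewrite !dotpLin /pm1.
    by rewrite (dotpC mu2) mu12 (dotp_mu1 mu1rho) subr0 divff// expf_neq0 ?gt_eqF.
  by rewrite mu12 (dotp_mu2 mu2rho) add0r mulNr divff// expf_neq0 ?gt_eqF.
move=> j /horth; rewrite /not_orth /= => /contrapT[h1 h2].
by rewrite !dotpLin h1 h2 subr0.
Qed.

Lemma clean_label c pos (xi : m.-tuple 'cV[R]_d) :
  (forall i, ~ not_orth (tnth xi i)) ->
  label (clean_tokens (mu c) pos xi) = pm1 R c.
Proof.
move=> h; apply: (@labelE _ pos); first exact: token_clean_pos.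
move=> j jp; case: (unliftP pos j) jp => [i|] ->; last by rewrite eqxx.
by move=> _; rewrite token_clean_lift.
Qed.

Lemma measurable_label : measurable_fun setT (fun s : sample => label s.1).
Proof.
apply: measurable_funM => //; apply: measurable_sum => j.
apply: measurable_dotp => //; apply: measurable_token; exact: measurable_fst.
Qed.

Definition mislabeled : set sample := [set s | s.2 <> label s.1].

Definition not_class c : set sample := [set s | label s.1 <> pm1 R c].

Lemma measurable_mislabeled : measurable mislabeled.
Proof.
rewrite (_ : mislabeled = ~` [set s | s.2 - label s.1 = 0]).
  apply: measurableC; apply: measurable_eq_cst; apply: measurable_funB.
    exact: measurable_snd.
  exact: measurable_label.
apply/seteqP; split => s /= h e; apply: h; first by apply/eqP; rewrite -subr_eq0 e.
by rewrite e subrr.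
Qed.

Lemma measurable_not_class c : measurable (not_class c).
Proof. by apply: measurableC; apply: measurable_eq_cst; exact: measurable_label. Qed.

(** The event forces some noise token to have a component along a signal, which has probability
    0. *)
Lemma clean_orth_le0 c pos (A : set sample) : measurable A ->
  (forall xi, label (clean_tokens (mu c) pos xi) = pm1 R c ->
     ~ A (clean_tokens (mu c) pos xi, pm1 R c)) ->
  (iid_prob N m [set xi | A (clean_tokens (mu c) pos xi, pm1 R c)] <= 0)%E.
Proof.
move=> mA hA; apply: (@prob_le _ _ _ _ _ [set xi | exists i, not_orth (tnth xi i)]).
- have := @measurable_clean_sample R d m mu1 mu2.
  move=> /measurable_preimage /(_ mA) /(measurable_section (c, pos)).
  by apply.
- by apply: measurable_iid_exists; exact: measurable_not_orth.
- move=> xi /= Axi; apply: contrapT => /forallNP h.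
  by apply: hA Axi; exact: clean_label.
- rewrite -(mulr0 m%:R); apply: iid_exists_le; first exact: measurable_not_orth.
  exact: noise_not_orth.
Qed.

Lemma mislabeled_le : (Dn mislabeled <= eta%:E)%E.
Proof.
rewrite -[eta in leRHS]addr0; apply: D_noisy_flip_le => //; first exact: measurable_mislabeled.
apply: D_clean_le => // [|c pos]; first exact: measurable_mislabeled.
apply: clean_orth_le0; first exact: measurable_mislabeled.
by move=> xi h; apply => /=; rewrite h.
Qed.

Lemma not_class_le c : (Dn (not_class c) <= (2^-1)%:E)%E.
Proof.
apply: D_noisy_le; first exact: measurable_not_class.
rewrite (_ : [set s | _] = not_class c); last by apply/seteqP; split => s /=; [case|left].
apply: (@D_clean_class_le _ _ _ _ _ _ _ c); first exact: measurable_not_class.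
move=> pos; apply: clean_orth_le0; first exact: measurable_not_class.
by move=> xi h; apply => /=; rewrite h.
Qed.

Definition well_formed c pos s : Prop :=
  [/\ forall k, s.1 pos k = mu c k 0,
      forall j, j != pos -> ~ bad_token (token s.1 j),
      forall j j', [&& j != pos, j' != pos & j != j'] ->
        ~ (t <= `|dotp (token s.1 j) (token s.1 j')|) &
      s.2 = 1 \/ s.2 = -1].

(** Class and signal position are hidden, hence quantified; their finite range keeps the event
    measurable. *)
Definition ill_formed : set sample :=
  ~` [set s | exists2 cp : bool * 'I_m.+1, true & well_formed cp.1 cp.2 s].

Lemma well_formed_pos c pos s : well_formed c pos s -> token s.1 pos = mu c.
Proof. by case=> h _ _ _; apply/matrixP => k j; rewrite !mxE ord1. Qed.

Let measurable_tok j : measurable_fun setT (fun s => token s.1 j).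
Proof. by apply: measurable_token; exact: measurable_fst. Qed.

Lemma measurable_ill_formed : measurable ill_formed.
Proof.
apply: measurableC.
apply: (@measurable_exists _ _ _ (fun=> true)
  (fun cp : bool * 'I_m.+1 => [set s | well_formed cp.1 cp.2 s])) => -[c pos].
have m1 : measurable [set s : sample | forall k, s.1 pos k = mu c k 0].
  apply: measurable_forall => k; apply: measurable_eq_cst.
  by have /measurable_fun_mxP := @measurable_fst _ _ 'M[R]_(m.+1, d) R; apply.
have m2 : measurable [set s : sample | forall j, j != pos -> ~ bad_token (token s.1 j)].
  apply: (measurable_forall (A := fun j =>
    [set s : sample | j != pos -> ~ bad_token (token s.1 j)])) => j.
  apply: measurable_imply; apply: measurableC.
  exact: measurable_preimage (measurable_tok j) measurable_bad_token.
have m3 : measurable [set s : sample | forall jj : 'I_m.+1 * 'I_m.+1,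
     [&& jj.1 != pos, jj.2 != pos & jj.1 != jj.2] ->
        ~ (t <= `|dotp (token s.1 jj.1) (token s.1 jj.2)|)].
  apply: (measurable_forall (A := fun jj : 'I_m.+1 * 'I_m.+1 => [set s : sample |
    [&& jj.1 != pos, jj.2 != pos & jj.1 != jj.2] ->
        ~ (t <= `|dotp (token s.1 jj.1) (token s.1 jj.2)|)])) => -[j j'].
  apply: measurable_imply; apply: measurableC; apply: measurable_ge_fun.
  by apply: measurableT_comp; [exact: normr_measurable|exact: measurable_dotp].
have m4 : measurable [set s : sample | s.2 = 1 \/ s.2 = -1].
  by apply: measurableU; apply: measurable_eq_cst; exact: measurable_snd.
have := measurableI _ _ (measurableI _ _ m1 m2) (measurableI _ _ m3 m4).
congr measurable; apply/seteqP; split => s /=.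
  by move=> [[h1 h2] [h3 h4]]; split => // j j'; exact: (h3 (j, j')).
by move=> [h1 h2 h3 h4]; split; split => //= -[j j']; exact: h3.
Qed.

Definition overlap : set ('cV[R]_d * 'cV[R]_d) :=
  [set w | t <= `|dotp w.1 w.2|].

Lemma measurable_overlap : measurable overlap.
Proof.
apply: measurable_ge_fun; apply: measurableT_comp; first exact: normr_measurable.
by apply: measurable_dotp; [exact: measurable_fst|exact: measurable_snd].
Qed.

(** The label [c'] is independent of the class [c], so that flipped labels are covered. *)
Lemma clean_well_formed c c' pos xi : ~ conflict bad_token overlap xi ->
  well_formed c pos (clean_tokens (mu c) pos xi, pm1 R c').
Proof.
move=> nc; split => /=.
- move=> k.
  have := congr1 (fun M : 'cV[R]_d => M k 0) (token_clean_pos (mu c) pos xi).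
  by rewrite !mxE.
- move=> j; case: (unliftP pos j) => [i|] ->; last by rewrite eqxx.
  by move=> _; rewrite token_clean_lift => h; apply: nc; left; exists i.
- move=> j j'; case: (unliftP pos j) => [i|] ->; last by rewrite eqxx.
  case: (unliftP pos j') => [i'|] ->; last by rewrite eqxx andbF.
  rewrite !token_clean_lift => /and3P[_ _ ii'] h; apply: nc; right.
  have {}ii' : i != i' by apply: contraNneq ii' => ->.
  have [ij|ij] := ltnP i i'; first by exists i, i'.
  exists i', i; split; last by rewrite /overlap/= dotpC.
  by rewrite ltn_neqAle ij eq_sym andbT.
- by case: c'; [left|right].
Qed.

Lemma noise_overlap_le x : dotp x x <= 4 * d%:R ->
  (N [set y | overlap (x, y)] <= (2 * E)%:E)%E.
Proof. by move=> xd; apply: noise_dotp_abs_tail => //; rewrite mulr_gt0. Qed.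

Definition ill_rate : R := m%:R * (6 * expR (- (d%:R / 64))) + m%:R ^+ 2 * (2 * E).

Lemma ill_formed_le : (Dn ill_formed <= ill_rate%:E)%E.
Proof.
have r0 : 0 <= ill_rate by rewrite addr_ge0// mulr_ge0 ?exprn_ge0 ?mulr_ge0 ?expR_ge0.
have mI := measurable_ill_formed.
have mF : measurable_fun setT (fun s : sample => (s.1, - s.2)).
  apply/measurable_fun_pairP; split; first exact: measurable_fst.
  exact: measurableT_comp (@oppr_measurable R setT) measurable_snd.
have mA : measurable [set s : sample | ill_formed s \/ ill_formed (s.1, - s.2)].
  by apply: measurableU => //; exact: (measurable_preimage mF).
apply: D_noisy_le => //; apply: D_clean_le => // c pos.
apply: (@prob_le _ _ _ _ _ (conflict bad_token overlap)).
- have := @measurable_clean_sample R d m mu1 mu2.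
  move=> /measurable_preimage /(_ mA) /(measurable_section (c, pos)).
  by apply.
- exact: measurable_conflict measurable_bad_token measurable_overlap.
- move=> xi /= h; apply: contrapT => nc.
  have wf c' := clean_well_formed c c' pos nc.
  have pmN : - pm1 R c = pm1 R (~~ c) by case: c {h wf}; rewrite /pm1 ?opprK.
  by case: h => h; apply: h; exists (c, pos); rewrite /= ?pmN//; exact: wf.
- apply: iid_conflict_le.
  + exact: measurable_bad_token.
  + exact: measurable_overlap.
  + by rewrite mulr_ge0 ?expR_ge0.
  + exact: noise_bad_token_le.
  + move=> x /= nb; apply: noise_overlap_le; rewrite leNgt; apply/negP => /ltW h.
    by apply: nb; left; left.
Qed.

(** Projecting by [P] kills the signal of the first sample, makes its tokens orthogonal to the
    signal of the second, and fixes noise tokens orthogonal to the signals. So all pairs of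
    positions can be tested without knowing where the signals are. *)
Definition sample_overlap : set (sample * sample) :=
  [set w | exists2 jj : 'I_m.+1 * 'I_m.+1, true &
    t <= `|dotp (P *m token w.1.1 jj.1) (token w.2.1 jj.2)|].

Lemma measurable_sample_overlap : measurable sample_overlap.
Proof.
apply: (@measurable_exists _ _ _ (fun=> true) (fun jj : 'I_m.+1 * 'I_m.+1 =>
  [set w : sample * sample |
    t <= `|dotp (P *m token w.1.1 jj.1) (token w.2.1 jj.2)|])) => -[j j'].
apply: measurable_ge_fun; apply: measurableT_comp; first exact: normr_measurable.
apply: measurable_dotp.
  apply: measurable_mulmx => //; apply: measurable_token.
  exact: (measurableT_comp measurable_fst measurable_fst).
apply: measurable_token.
exact: (measurableT_comp measurable_fst measurable_snd).
Qed.

Lemma well_formed_norm s j : ~ ill_formed s ->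
  dotp (P *m token s.1 j) (P *m token s.1 j) <= 4 * d%:R.
Proof.
move=> /contrapT[[c pos] _ /= wf].
have [->|jp] := eqVneq j pos.
  rewrite (well_formed_pos wf); case: c {wf}.
    by rewrite (noise_cov_mu1 rho0 mu12 mu1rho) dotp0l mulr_ge0.
  by rewrite (noise_cov_mu2 rho0 mu12 mu2rho) dotp0l mulr_ge0.
apply: (le_trans (dotp_noise_cov_le rho0 mu12 mu1rho mu2rho _)).
have [_ h _ _] := wf; have {}h := h j jp.
by rewrite leNgt; apply/negP => /ltW h'; apply: h; left; left.
Qed.

Definition overlap_rate : R := m%:R * (m.+1%:R * (2 * E)).

Lemma sample_overlap_le s : ~ ill_formed s ->
  (Dn [set s' | sample_overlap (s, s')] <= overlap_rate%:E)%E.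
Proof.
move=> wf.
have E0 : 0 <= 2 * E by rewrite mulr_ge0 ?expR_ge0.
have r0 : 0 <= overlap_rate by rewrite mulr_ge0// mulr_ge0.
have mA : measurable [set s' | sample_overlap (s, s')].
  exact: measurable_section measurable_sample_overlap.
apply: D_noisy_le => //.
rewrite (_ : [set _ | _] = [set s' | sample_overlap (s, s')]); last first.
  by apply/seteqP; split => s' /=; [case|left].
apply: D_clean_le => // c pos.
pose B : set 'cV[R]_d := [set x | exists2 j : 'I_m.+1, true &
  t <= `|dotp (P *m token s.1 j) x|].
have mBj j : measurable [set x : 'cV[R]_d | t <= `|dotp (P *m token s.1 j) x|].
  apply: measurable_ge_fun; apply: measurableT_comp; last exact: measurable_dotpr.
  exact: normr_measurable.
have mB : measurable B by apply: (@measurable_exists _ _ _ (fun=> true)).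
apply: (@prob_le _ _ _ _ _ [set xi | exists i, B (tnth xi i)]).
- have := @measurable_clean_sample R d m mu1 mu2.
  move=> /measurable_preimage /(_ mA) /(measurable_section (c, pos)).
  by apply.
- exact: measurable_iid_exists.
- move=> xi /= [[j j'] _ /=]; case: (unliftP pos j') => [i|] ->.
    by rewrite token_clean_lift => h; exists i; exists j.
  rewrite token_clean_pos dotpC; case: c.
    by rewrite (dotp_mu1_noise rho0 mu12 mu1rho) normr0 leNgt t0.
  by rewrite (dotp_mu2_noise rho0 mu12 mu2rho) normr0 leNgt t0.
- apply: iid_exists_le => //.
  have := @prob_exists_le _ _ _ N _ (fun=> true) (fun j => [set x : 'cV[R]_d |
     (t <= `|dotp (P *m token s.1 j) x|)%R]) _ E0 mBj.
  rewrite (_ : #|_| = m.+1); last by rewrite -[RHS]card_ord; apply: eq_card.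
  by apply => j _; apply: noise_overlap_le; exact: well_formed_norm.
Qed.

End events.

(** * Test error *)

Section test_error.
Context (R : realType) (d m : nat) (rho eta : R) (mu1 mu2 : 'cV[R]_d).
Hypotheses (eta0 : 0 <= eta) (eta1 : eta <= 1) (m0 : (0 < m)%N).
Hypotheses (rho0 : 0 < rho) (mu12 : dotp mu1 mu2 = 0)
  (mu1rho : l2norm mu1 = rho) (mu2rho : l2norm mu2 = rho).
Local Notation mu := (fun c : bool => if c then mu1 else mu2).
Local Notation N := (gaussian (noise_cov rho mu1 mu2)).
Local Notation sample := ('M[R]_(m.+1, d) * R)%type.
Implicit Types (v p : 'cV[R]_d) (s : sample).

Definition score v p (X : 'M[R]_(m.+1, d)) : R :=
  \sum_j expR (dotp p (token X j)) * dotp v (token X j).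

Lemma sgr_attn v p X : Num.sg (attn X v p) = Num.sg (score v p X).
Proof.
rewrite attnE sgrM sgrV (gtr0_sg (x := \sum_j expR _)) ?mulr1//.
exact: sum_expR_gt0 ord0.
Qed.

Lemma measurable_score v p : measurable_fun setT (fun s : sample => score v p s.1).
Proof.
have mt j : measurable_fun setT (fun s : sample => token s.1 j).
  by apply: measurable_token; exact: measurable_fst.
apply: measurable_sum => j; apply: measurable_funM; last exact: measurable_dotp.
by apply: measurableT_comp; [exact: measurable_expR|exact: measurable_dotp].
Qed.

Definition misclassified v p : set sample := [set s | s.2 <> Num.sg (attn s.1 v p)].

Lemma measurable_misclassified v p : measurable (misclassified v p).
Proof.
have mc (a : R) (B : set R) : measurable B ->
    measurable [set s : sample | s.2 = a /\ B (score v p s.1)].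
  move=> mB; apply: measurableI.
    by apply: measurable_eq_cst; exact: measurable_snd.
  exact: measurable_preimage (measurable_score v p) mB.
have -> : misclassified v p = ~` (
    [set s | s.2 = 1 /\ [set x | 0 < x] (score v p s.1)] `|`
    ([set s | s.2 = 0 /\ [set x | x = 0] (score v p s.1)] `|`
     [set s | s.2 = -1 /\ [set x | x < 0] (score v p s.1)])).
  congr (~` _); apply/seteqP; split => s /=; rewrite sgr_attn.
    case: (sgrP (score v p s.1)) => h e; [right; left|left|right; right] => //.
  by move=> [[-> h]|[[-> ->]|[-> h]]]; rewrite ?(gtr0_sg h) ?(ltr0_sg h) ?sgr0.
apply: measurableC; apply: measurableU; [|apply: measurableU]; apply: mc.
- have := @measurable_itv R `]0, +oo[; congr measurable.
  by apply/seteqP; split => x /=; rewrite in_itv/= andbT.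
- exact: measurable_set1.
- by have := @measurable_itv R `]-oo, 0[; congr measurable.
Qed.

(** If every noise token has score below that of the signal and value below [g / (2 * m)], the [m]
    noise terms together are at most half the signal term, which then decides the sign. *)
Lemma misclassified_le (g L V W : R) v p :
  0 < g -> 0 < L -> 0 < V -> 0 < W ->
  (forall c, g <= pm1 R c * dotp (mu c) v) -> (forall c, L <= dotp (mu c) p) ->
  dotp v v <= V -> dotp p p <= W ->
  (D_noisy m rho mu1 mu2 eta (misclassified v p) <=
   (eta + m%:R * (2 * expR (- ((g / (2 * m%:R)) ^+ 2 / (2 * V)))
                   + expR (- (L ^+ 2 / (2 * W)))))%:E)%E.
Proof.
move=> g0 L0 V0 W0 hg hL hV hW.
have mp : 0 < m%:R :> R by rewrite ltr0n.
have mM := measurable_misclassified v p.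
set q := _ + expR (- (L ^+ 2 / _)).
have q0 : 0 <= m%:R * q by rewrite mulr_ge0// addr_ge0 ?mulr_ge0 ?expR_ge0.
apply: D_noisy_flip_le => //; apply: D_clean_le => // c pos.
pose B : set 'cV[R]_d := [set x | g / (2 * m%:R) <= `|dotp v x|] `|`
  [set x | L <= dotp p x].
have m1 : measurable [set x : 'cV[R]_d | g / (2 * m%:R) <= `|dotp v x|].
  apply: measurable_ge_fun; apply: measurableT_comp; last exact: measurable_dotpr.
  exact: normr_measurable.
have m2 : measurable [set x : 'cV[R]_d | L <= dotp p x].
  by apply: measurable_ge_fun; exact: measurable_dotpr.
have mB : measurable B by exact: measurableU.
apply: (@prob_le _ _ _ _ _ [set xi | exists i, B (tnth xi i)]).
- have := @measurable_clean_sample R d m mu1 mu2.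
  by move=> /measurable_preimage /(_ mM) /(measurable_section (c, pos)).
- exact: measurable_iid_exists.
- move=> xi /=; apply: contraPP => /forallNP nB.
  rewrite /misclassified /= sgr_attn; apply/contrapT; apply.
  suff : 0 < pm1 R c * score v p (clean_tokens (mu c) pos xi).
    by case: (c); rewrite /pm1 ?mul1r ?mulN1r ?oppr_gt0 => h; rewrite ?(gtr0_sg h) ?(ltr0_sg h).
  rewrite /score (bigD1 pos)//= token_clean_pos mulrDr mulrCA.
  have s0 : expR (dotp p (mu c)) * g <= expR (dotp p (mu c)) * (pm1 R c * dotp v (mu c)).
    by rewrite ler_pM2l ?expR_gt0// dotpC.
  set rest := \sum_(j | _) _.
  have hr : `|rest| <= expR (dotp p (mu c)) * (g / 2).
    apply: (@le_trans _ _ (\sum_(j | j != pos) expR (dotp p (mu c)) * (g / (2 * m%:R)))).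
      apply: (le_trans (ler_norm_sum _ _ _)); apply: ler_sum => j.
      case: (unliftP pos j) => [i|] ->; last by rewrite eqxx.
      move=> _; rewrite token_clean_lift normrM ger0_norm ?expR_ge0//.
      have nBi := nB i; apply: ler_pM => //.
        rewrite ler_expR; apply: (@le_trans _ _ L); last by rewrite dotpC.
        by rewrite leNgt; apply/negP => /ltW h; apply: nBi; right.
      by rewrite leNgt; apply/negP => /ltW h; apply: nBi; left.
    rewrite sumr_const (_ : #|_| = m); last first.
      have h : #|predC1 pos| = m by rewrite cardC1 card_ord.
      by rewrite -[RHS]h; apply: eq_card => j; rewrite !inE.
    rewrite -mulr_natl le_eqVlt; apply/orP; left; apply/eqP.
    by field; rewrite gt_eqF.
  have e0 : 0 < expR (dotp p (mu c)) * g by rewrite mulr_gt0 ?expR_gt0.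
  have : - `|rest| <= pm1 R c * rest.
    have : `|rest| = `|pm1 R c * rest| by case: (c); rewrite /pm1 normrM ?normrN normr1 mul1r.
    by move=> ->; rewrite lerNl -normrN ler_norm.
  by have := hr; rewrite mulrA; lra.
- apply: iid_exists_le => //; apply: prob_setU_le => //.
    by apply: noise_dotp_abs_tail => //; rewrite divr_gt0// mulr_gt0.
  exact: noise_dotp_tail.
Qed.

End test_error.

(** * Good training sets are likely *)

Section good_training_set.
Context (R : realType) (d n m : nat) (rho t : R) (mu1 mu2 : 'cV[R]_d).
Hypotheses (rho0 : 0 < rho) (mu12 : dotp mu1 mu2 = 0)
  (mu1rho : l2norm mu1 = rho) (mu2rho : l2norm mu2 = rho).
Local Notation mu := (fun c : bool => if c then mu1 else mu2).
Context (S : n.-tuple ('M[R]_(m.+1, d) * R)).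
Hypothesis S_good : ~ conflict (ill_formed t mu1 mu2) (sample_overlap rho t mu1 mu2) S.
Local Notation x i j := (token (tnth S i).1 j).
Local Notation y i := (tnth S i).2.

Lemma good_well_formed : exists (b : 'I_n -> bool) (pos : 'I_n -> 'I_m.+1),
  forall i, well_formed t mu1 mu2 (b i) (pos i) (tnth S i).
Proof.
have h i : exists cp : bool * 'I_m.+1, well_formed t mu1 mu2 cp.1 cp.2 (tnth S i).
  apply: contrapT => h; apply: S_good; left; exists i => -[cp _ wf].
  by apply: h; exists cp.
by exists (fun i => (projT1 (cid (h i))).1), (fun i => (projT1 (cid (h i))).2) => i;
  case: cid.
Qed.

Section decoded.
Context (b : 'I_n -> bool) (pos : 'I_n -> 'I_m.+1).
Hypothesis wf : forall i, well_formed t mu1 mu2 (b i) (pos i) (tnth S i).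

Lemma good_orth i j : j != pos i ->
  dotp mu1 (x i j) = 0 /\ dotp mu2 (x i j) = 0.
Proof.
move=> jp; have [_ /(_ j jp) h _ _] := wf i.
by apply: contrapT => h'; apply: h; right.
Qed.

Lemma good_norm i j : j != pos i -> d%:R / 16 <= dotp (x i j) (x i j) <= 4 * d%:R.
Proof.
move=> jp; have [_ /(_ j jp) h _ _] := wf i.
apply/andP; split; rewrite leNgt; apply/negP => /ltW h'; apply: h; left.
  by right.
by left.
Qed.

Lemma good_overlap i j i' j' : j != pos i -> j' != pos i' ->
  (i, j) != (i', j') -> `|dotp (x i j) (x i' j')| <= t.
Proof.
have lt_case (k k' : 'I_n) l l' : l != pos k -> (k < k')%N ->
    `|dotp (x k l) (x k' l')| <= t.
  move=> lk kk'; rewrite leNgt; apply/negP => /ltW h; apply: S_good; right.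
  exists k, k'; split => //; exists (l, l') => //=.
  by have [h1 h2] := good_orth lk; rewrite noise_cov_id.
move=> jp jp' ne.
have [ii'|ii'|ii'] := ltngtP i i'.
- exact: lt_case.
- by rewrite dotpC; exact: lt_case.
- have e : i = i' by exact: val_inj.
  subst i'; have [_ _ h _] := wf i.
  rewrite leNgt; apply/negP => /ltW; apply: h; rewrite jp jp'/=.
  by apply: contraNneq ne => ->.
Qed.

Lemma good_label i : label rho mu1 mu2 (tnth S i).1 = pm1 R (b i).
Proof.
apply: labelE (well_formed_pos (wf i)) _ => // j jp.
by have [_ /(_ j jp) h _ _] := wf i => h'; apply: h; right.
Qed.

Local Notation mis := (mislabeled rho mu1 mu2 (m := m)).
Local Notation notc := (not_class rho mu1 mu2 (m := m)).

Lemma card_noisy :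
  #|noisy S b|%:R = \sum_i \1_mis (tnth S i) :> R.
Proof.
rewrite -sum1_card natr_sum big_mkcond/=; apply: eq_bigr => i _.
rewrite indicE -topredE/= /noisy -(good_label i).
have [e|/eqP ne] := eqVneq (y i) (label rho mu1 mu2 (tnth S i).1).
  by rewrite memNset//= => /(_ e).
by rewrite mem_set.
Qed.

Lemma card_clean_class c :
  n%:R - \sum_i \1_(notc c) (tnth S i) - \sum_i \1_mis (tnth S i) <=
  #|[pred i | (b i == c) && ~~ noisy S b i]|%:R :> R.
Proof.
rewrite -card_noisy -!sum1_card !natr_sum.
have -> : n%:R = \sum_(i < n) 1 :> R by rewrite sumr_const card_ord.
rewrite [\sum_(i in noisy S b) _]big_mkcond/= [leRHS]big_mkcond/= -!sumrB.
apply: ler_sum => i _; rewrite -!topredE/= indicE.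
case: (noisy S b i); rewrite ?andbF ?andbT/=.
  by case: (_ \in _) => /=; lra.
have [e|/eqP ne] := eqVneq (b i) c; first by case: (_ \in _) => /=; lra.
rewrite mem_set/=; first by lra.
rewrite /not_class/= good_label => e; apply: ne.
case: (b i) c e => [] [] //= /eqP; rewrite /pm1 => /eqP; lra.
Qed.

End decoded.
End good_training_set.

(** * Numerical estimates *)

Section rates.
Context (R : realType).

Lemma class_rate (n : nat) (x : R) : 64 * x <= n%:R ->
  (1 + 2^-1) ^+ n * expR (- (ln 2 * (3 / 4 * n%:R))) <= expR (- (4 * x)).
Proof.
move=> hn; pose u : R := 3 / 2 * expR (- (ln 2 * (3 / 4))).
have -> : (1 + 2^-1) ^+ n * expR (- (ln 2 * (3 / 4 * n%:R))) = u ^+ n.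
  by rewrite /u exprMn -expRM_natl; congr (_ ^+ _ * expR _); [field|ring].
(* The fourth power is rational, and [81 / 128 <= 3 / 4 <= expR (- 4^-1)]. *)
have u4 : u ^+ 4 = 81 / 128.
  rewrite /u exprMn -expRM_natl (_ : 4%:R * _ = - (3%:R * ln 2)); last by field.
  by rewrite expRN expRM_natl lnK ?posrE//; field.
have ub : u <= expR (- 16^-1).
  rewrite -(@ler_pXn2r _ 4)// ?nnegrE ?mulr_ge0 ?expR_ge0//.
  rewrite u4 -expRM_natl; have := @expR_ge1Dx R (4%:R * - 16^-1); lra.
apply: (@le_trans _ _ (expR (- 16^-1) ^+ n)).
  by rewrite lerXn2r ?nnegrE ?mulr_ge0 ?expR_ge0.
by rewrite -expRM_natl ler_expR; lra.
Qed.

(** As [ln 2 >= 1 / 2], the exponent is at most [n * (k / 4 - k / 2) = - k * n / 4]. *)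
Lemma mislabeled_rate (n : nat) (eta k x : R) : 0 <= eta -> 0 < k ->
  eta <= k / 4 -> 16 / k * x <= n%:R ->
  (1 + eta) ^+ n * expR (- (ln 2 * (k * n%:R))) <= expR (- (4 * x)).
Proof.
move=> e0 k0 ek hn.
apply: (@le_trans _ _ (expR eta ^+ n * expR (- (ln 2 * (k * n%:R))))).
  by rewrite ler_pM2r ?expR_gt0// lerXn2r ?nnegrE ?addr_ge0 ?expR_ge0// expR_ge1Dx.
rewrite -expRM_natl -expRD ler_expR.
have kn : 16 * x <= k * n%:R.
  by rewrite -(ler_pM2l k0) mulrA mulrCA divff ?gt_eqF// mulr1 mulrC in hn *.
have kn0 : 0 <= k * n%:R by rewrite mulr_ge0// ltW.
have h1 : n%:R * eta <= n%:R * (k / 4) by rewrite ler_wpM2l.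
have h2 := ler_wpM2r kn0 (ln2_ge R).
lra.
Qed.

Lemma delta_pow (delta : R) : 0 < delta -> delta < 2^-1 ->
  expR (- (4 * ln delta^-1)) <= delta / 8.
Proof.
move=> d0 d2.
rewrite lnV ?posrE// mulrN opprK -[4]/(4%:R) expRM_natl lnK ?posrE//.
have h2 : delta ^+ 2 <= 4^-1 by nra.
have h3 : 0 <= delta ^+ 2 by exact: sqr_ge0.
nra.
Qed.

End rates.

Section conflict_rate.
Context (R : realType) (cT delta C : R) (d n m : nat).
Local Notation omega := ((8 * 256 ^+ 2 * cT ^+ 2)^-1 : R).
Local Notation t := (d%:R / (256 * (n%:R * m.+1%:R)) : R).
Local Notation h := (d%:R / n%:R ^+ 2 : R).
Hypotheses (cT2 : 2 <= cT) (n0 : (0 < n)%N) (d0 : (0 < d)%N).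
Hypotheses (mcT : m.+1%:R <= cT).
Hypotheses (delta0 : 0 < delta) (delta2 : delta < 2^-1).
Hypothesis dC : C * n%:R ^+ 2 * ln (n%:R / delta) <= d%:R.
Hypothesis C_ge : (2 + 20 * cT ^+ 2) / omega <= C.

Let np : 0 < n%:R :> R. Proof. by rewrite ltr0n. Qed.
Let dp : 0 < d%:R :> R. Proof. by rewrite ltr0n. Qed.
Let n1 : 1 <= n%:R :> R. Proof. by rewrite ler1n. Qed.
Let cT4 : 4 <= cT ^+ 2. Proof. by have := cT2; nra. Qed.
Let om0 : 0 < omega.
Proof. by rewrite invr_gt0; have := cT4; lra. Qed.

Let ell_ge : 2^-1 <= ln (n%:R / delta).
Proof.
apply: (le_trans (ln2_ge R)); rewrite ler_ln ?posrE ?divr_gt0//.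
by rewrite ler_pdivlMr//; have := n1; have := delta2; lra.
Qed.

Lemma sqr_ratio_ge : C * ln (n%:R / delta) <= h.
Proof. by rewrite ler_pdivlMr ?exprn_gt0// mulrAC. Qed.

Lemma conflict_rate_le :
  n%:R * ill_rate d m t + n%:R ^+ 2 * overlap_rate d m t <= delta / 2.
Proof.
(* [omega] is the rate common to all the tails: [t ^ 2 / (8 * d)] equals
   [h / (8 * 256 ^ 2 * m.+1 ^ 2)], and [m.+1 <= cT]. *)
pose e := expR (- (omega * h)).
have mc : m%:R <= cT by apply: le_trans mcT; rewrite ler_nat.
have m1 : 0 < m.+1%:R :> R by rewrite ltr0n.
have he1 : expR (- (d%:R / 64)) <= e.
  rewrite ler_expR lerN2.
  have hd : h <= d%:R.
    by rewrite ler_pdivrMr ?exprn_gt0// ler_peMr// exprn_ege1.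
  have om : omega <= 64^-1.
    by rewrite lef_pV2 ?posrE; have := cT4; lra.
  have h0 : 0 <= h by rewrite divr_ge0 ?exprn_ge0.
  by have := ler_pM (ltW om0) h0 om hd; rewrite mulrC [in leRHS]mulrC.
have he2 : expR (- (t ^+ 2 / (2 * (4 * d%:R)))) <= e.
  rewrite ler_expR lerN2.
  have -> : t ^+ 2 / (2 * (4 * d%:R)) = (8 * 256 ^+ 2 * m.+1%:R ^+ 2)^-1 * h.
    by field; rewrite !gt_eqF.
  rewrite ler_pM2r; last by rewrite divr_gt0 ?exprn_gt0.
  have m2 : m.+1%:R ^+ 2 <= cT ^+ 2.
    by rewrite ler_pXn2r ?nnegrE ?(ltW m1)// (le_trans (ltW m1)).
  have m20 : 0 < m.+1%:R ^+ 2 :> R by rewrite exprn_gt0.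
  by rewrite lef_pV2 ?posrE; lra.
have e0 : 0 <= e by exact: expR_ge0.
rewrite /ill_rate /overlap_rate.
have := expR_ge0 (- (d%:R / 64) : R).
have := expR_ge0 (- (t ^+ 2 / (2 * (4 * d%:R)))).
move: he1 he2; set e1 := expR (- (d%:R / 64)); set e2 := expR (- (t ^+ 2 / _)).
move: e1 e2 => e1 e2 he1 he2 e20 e10.
apply: (@le_trans _ _ (10 * cT ^+ 2 * (n%:R ^+ 2 * e))).
  have mm : m%:R ^+ 2 <= cT ^+ 2 by rewrite ler_pXn2r ?nnegrE//; have := cT2; lra.
  have mm1 : m%:R * m.+1%:R <= cT ^+ 2 by rewrite expr2; apply: ler_pM.
  have mc2 : m%:R <= cT ^+ 2 by have := cT2; nra.
  have nn : n%:R <= n%:R ^+ 2 :> R by have := n1; nra.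
  have a1 : n%:R * m%:R * e1 <= n%:R ^+ 2 * cT ^+ 2 * e.
    by apply: ler_pM; rewrite ?mulr_ge0//; exact: ler_pM.
  have a2 : n%:R * m%:R ^+ 2 * e2 <= n%:R ^+ 2 * cT ^+ 2 * e.
    by apply: ler_pM; rewrite ?mulr_ge0 ?exprn_ge0//; apply: ler_pM; rewrite ?exprn_ge0.
  have a3 : n%:R ^+ 2 * (m%:R * m.+1%:R) * e2 <= n%:R ^+ 2 * cT ^+ 2 * e.
    by apply: ler_pM; rewrite ?mulr_ge0 ?exprn_ge0// ler_pM2l ?exprn_gt0.
  lra.
pose l := ln (n%:R / delta).
(* By [C_ge] and [l >= 1 / 2], the exponent is at least [2 * l + 10 * cT ^ 2]: the first part yields
   [(delta / n) ^ 2], the second cancels the constant of the union bound. *)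
have le : e <= (delta / n%:R) ^+ 2 * (1 + 10 * cT ^+ 2)^-1.
  apply: (@le_trans _ _ (expR (- (2 * l)) * expR (- (10 * cT ^+ 2)))).
    rewrite -expRD ler_expR -opprD lerN2.
    apply: (@le_trans _ _ (omega * (C * l))); last by rewrite ler_pM2l// sqr_ratio_ge.
    have : 2 + 20 * cT ^+ 2 <= omega * C by rewrite (mulrC omega) -ler_pdivrMr.
    have := ell_ge; rewrite -/l; have := cT4; rewrite mulrA; nra.
  apply: ler_pM; rewrite ?expR_ge0//.
    rewrite -[2]/(2%:R) -mulrN expRM_natl expRN lnK ?posrE ?divr_gt0//.
    by rewrite invf_div.
  rewrite expRN lef_pV2 ?posrE ?expR_gt0 ?expR_ge1Dx//; have := cT4; lra.
apply: (@le_trans _ _ (10 * cT ^+ 2 * (n%:R ^+ 2 *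
    ((delta / n%:R) ^+ 2 * (1 + 10 * cT ^+ 2)^-1)))).
  apply: ler_wpM2l; first by have := cT4; lra.
  by rewrite ler_pM2l ?exprn_gt0.
have c0 : 0 < 1 + 10 * cT ^+ 2 by have := cT4; lra.
have -> : 10 * cT ^+ 2 * (n%:R ^+ 2 * ((delta / n%:R) ^+ 2 * (1 + 10 * cT ^+ 2)^-1)) =
   delta ^+ 2 * (10 * cT ^+ 2) / (1 + 10 * cT ^+ 2).
  by field; rewrite !gt_eqF.
rewrite ler_pdivrMr//.
have : delta ^+ 2 <= delta / 2 by have := delta0; have := delta2; nra.
have := delta0; have := cT4; nra.
Qed.

(** Lets the exponential absorb the factor [3 * m] of the union bound in [solution_error]. *)
Lemma sqr_ratio_ge_cT : 20 * cT <= h.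
Proof.
apply: le_trans sqr_ratio_ge.
have om1 : omega <= 1 by rewrite invf_le1; have := cT4; lra.
have C1 : 2 + 20 * cT ^+ 2 <= C.
  apply: le_trans C_ge; rewrite ler_pdivlMr// ler_piMr//.
  by have := cT4; lra.
have := ell_ge; have := cT2; nra.
Qed.

End conflict_rate.

(** Cubing [1 + L / 6 <= expR (L / 6)] gives [L ^ 3 / 216 <= g]; hence the constants 15, as
    [15 ^ 2 >= 216], and [432 = 2 * 216]. *)
Lemma large_margin (R : realType) (a : R) (m n : nat) (L g : R) :
  0 <= a -> 15 + 6 * (m%:R * (2 * n%:R + 3)) + 432 * a <= L -> g = expR (L / 2) ->
  [/\ 1 <= L, L <= g, 6 * (m%:R * (2 * n%:R + 3)) <= L ^+ 2,
      m%:R * (2 * n%:R + 3) <= g ^+ 2 & 2 * a * L ^+ 2 <= g].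
Proof.
move=> a0 hL ->.
have k0 : 0 <= m%:R * (2 * n%:R + 3) :> R by rewrite mulr_ge0// addr_ge0// mulr_ge0.
have L15 : 15 <= L by lra.
have hg : L ^+ 3 / 216 <= expR (L / 2).
  have -> : L / 2 = 3%:R * (L / 6) by field.
  rewrite expRM_natl; apply: (@le_trans _ _ ((L / 6) ^+ 3)).
    by rewrite le_eqVlt; apply/orP; left; apply/eqP; field.
  rewrite lerXn2r ?nnegrE ?expR_ge0 ?divr_ge0//; first lra.
  by apply: le_trans (expR_ge1Dx _); lra.
have L2 : L * 15 <= L ^+ 2 by nra.
have Lg : L <= expR (L / 2) by apply: le_trans hg; rewrite exprS; nra.
split => //; [lra|nra| |].
- by apply: (@le_trans _ _ L); [lra|nra].
- apply: le_trans hg; rewrite exprS; nra.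
Qed.

(** * The good event and the test error on it *)

Section good_event.
Context (R : realType) (cT C delta rho eta : R) (d n m : nat) (mu1 mu2 : 'cV[R]_d).
(** The factor [cT ^+ 2] in [theta] pays for the threshold [g / (2 * m)] in [misclassified_le].
    [kappa] bounds the fraction of noisy samples so that memorizing them takes half of the budget
    [theta * n / d]. *)
Local Notation theta := ((40 ^+ 2 * cT ^+ 2)^-1 : R).
Local Notation kappa := (theta / (10 * 128 ^+ 2) : R).
Local Notation omega := ((8 * 256 ^+ 2 * cT ^+ 2)^-1 : R).
Local Notation t := (d%:R / (256 * (n%:R * m.+1%:R)) : R).
Local Notation sample := ('M[R]_(m.+1, d) * R)%type.
Local Notation Dn := (D_noisy m rho mu1 mu2 eta).
Local Notation mis := (mislabeled rho mu1 mu2 (m := m)).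
Local Notation notc := (not_class rho mu1 mu2 (m := m)).
Hypotheses (cT2 : 2 <= cT) (C_ge : 64 + (2 + 20 * cT ^+ 2) / omega + 16 / kappa <= C).
Hypotheses (delta0 : 0 < delta) (delta2 : delta < 2^-1).
Hypotheses (rho0 : 0 < rho) (mu12 : dotp mu1 mu2 = 0)
  (mu1rho : l2norm mu1 = rho) (mu2rho : l2norm mu2 = rho).
Hypothesis dC : C * n%:R ^+ 2 * ln (n%:R / delta) <= d%:R.
Hypothesis nC : C * ln (delta^-1) <= n%:R.
Hypothesis rhoC : C * Num.sqrt (d%:R / n%:R) <= rho.
Hypotheses (eta0 : 0 <= eta) (eta2 : eta < 2^-1) (etaC : eta <= C^-1).
Hypotheses (m2 : (2 <= m.+1)%N) (mcT : m.+1%:R <= cT).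

Let cT4 : 4 <= cT ^+ 2. Proof. by have := cT2; nra. Qed.
Let theta0 : 0 < theta. Proof. by rewrite invr_gt0; have := cT4; lra. Qed.
Let kappa0 : 0 < kappa. Proof. by rewrite divr_gt0//; lra. Qed.
Let omega0 : 0 < omega. Proof. by rewrite invr_gt0; have := cT4; lra. Qed.

Let constant_parts (x y : R) : 0 <= x -> 0 <= y ->
  [/\ 64 <= 64 + x + y, x <= 64 + x + y & y <= 64 + x + y].
Proof. by move=> x0 y0; split; lra. Qed.

Let C_parts : [/\ 64 <= C, (2 + 20 * cT ^+ 2) / omega <= C & 16 / kappa <= C].
Proof.
have [||h1 h2 h3] := @constant_parts ((2 + 20 * cT ^+ 2) / omega) (16 / kappa).
- by rewrite divr_ge0 ?(ltW omega0)//; have := cT4; lra.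
- by rewrite divr_ge0 ?(ltW kappa0).
- by split; apply: le_trans C_ge.
Qed.

Let C64 : 64 <= C. Proof. by case: C_parts. Qed.
Let C_omega : (2 + 20 * cT ^+ 2) / omega <= C. Proof. by case: C_parts. Qed.
Let C_kappa : 16 / kappa <= C. Proof. by case: C_parts. Qed.

Let l0 : 2^-1 <= ln delta^-1.
Proof.
apply: (le_trans (ln2_ge R)); rewrite ler_ln ?posrE ?invr_gt0//.
by rewrite -[leLHS]invrK lef_pV2 ?posrE ?invr_gt0// ltW.
Qed.

Lemma n_gt0 : (0 < n)%N.
Proof.
rewrite -(ltr0n R); apply: lt_le_trans nC; rewrite mulr_gt0//; last by have := l0; lra.
by have := C64; lra.
Qed.

Let np : 0 < n%:R :> R. Proof. by rewrite ltr0n n_gt0. Qed.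

Lemma d_gt0 : (0 < d)%N.
Proof.
rewrite -(ltr0n R); apply: lt_le_trans dC; rewrite !mulr_gt0//.
  by have := C64; lra.
apply: ln_gt0; rewrite ltr_pdivlMr// mul1r.
have : 1 <= n%:R :> R by rewrite ler1n n_gt0.
by have := delta2; lra.
Qed.

Let dp : 0 < d%:R :> R. Proof. by rewrite ltr0n d_gt0. Qed.
Let t0 : 0 < t.
Proof.
apply: divr_gt0 => //; apply: mulr_gt0; first by lra.
by apply: mulr_gt0; rewrite // ltr0n.
Qed.
Let eta1 : eta <= 1. Proof. by have := eta2; lra. Qed.

(** The fraction [3 / 4] exceeds the mean [1 / 2], and its complement leaves
    [n / 4 - kappa * n >= n / 8] clean samples in each class. *)
Definition bad_training : set (n.-tuple sample) :=
  (conflict (ill_formed t mu1 mu2) (sample_overlap rho t mu1 mu2) `|`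
   [set S | (kappa * n%:R : R) <= \sum_i \1_mis (tnth S i)]) `|`
  ([set S | (3 / 4 * n%:R : R) <= \sum_i \1_(notc true) (tnth S i)] `|`
   [set S | (3 / 4 * n%:R : R) <= \sum_i \1_(notc false) (tnth S i)]).

Let measurable_count (A : set sample) (k : R) : measurable A ->
  measurable [set S : n.-tuple sample | k <= \sum_i \1_A (tnth S i)].
Proof.
move=> mA; apply: measurable_ge_fun.
exact: (measurable_sum_tnth (g := fun _ => \1_A) (fun=> measurable_indic mA)).
Qed.

Let measurable_conf : measurable
  (conflict (ill_formed t mu1 mu2) (sample_overlap rho t mu1 mu2) : set (n.-tuple sample)).
Proof.
apply: measurable_conflict; first exact: measurable_ill_formed.
exact: measurable_sample_overlap.
Qed.

Lemma measurable_bad_training : measurable bad_training.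
Proof.
apply: measurableU; apply: measurableU => //; apply: measurable_count;
  by [exact: measurable_mislabeled|exact: measurable_not_class].
Qed.

Lemma bad_training_le : (iid_prob Dn n bad_training <= delta%:E)%E.
Proof.
have xC : 64 * ln delta^-1 <= n%:R.
  by apply: le_trans nC; rewrite ler_wpM2r//; have := l0; lra.
have xk : 16 / kappa * ln delta^-1 <= n%:R.
  by apply: le_trans nC; rewrite ler_wpM2r//; have := l0; lra.
have etak : eta <= kappa / 4.
  apply: le_trans etaC _.
  have C0 : 0 < C by have := C64; lra.
  rewrite -[leRHS]invrK lef_pV2 ?posrE ?invr_gt0 ?divr_gt0//.
  rewrite invf_div; apply: le_trans C_kappa.
  by rewrite ler_pM2r ?invr_gt0//; lra.
have cls c : (iid_prob Dn n
    [set S | ((3 / 4 * n%:R : R) <= \sum_i \1_(notc c) (tnth S i))%R] <= (delta / 8)%:E)%E.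
  apply: le_trans (iid_count_tail _ _ (measurable_not_class _ _ _ _)
    (not_class_le _ _ _ _ _ _ _)) _ => //.
  rewrite lee_fin; apply: le_trans (class_rate xC) _.
  exact: delta_pow.
apply: (@le_trans _ _ ((delta / 2 + delta / 8) + (delta / 8 + delta / 8))%:E); last first.
  by rewrite lee_fin; have := delta0; lra.
have mm := @measurable_mislabeled R d m rho mu1 mu2.
have mc := @measurable_not_class R d m rho mu1 mu2.
apply: prob_setU_le.
- by apply: measurableU => //; exact: measurable_count.
- by apply: measurableU; exact: measurable_count.
- apply: prob_setU_le => //; first exact: measurable_count.
    apply: le_trans (_ : (_ <=
      (n%:R * ill_rate d m t + n%:R ^+ 2 * overlap_rate d m t)%:E)%E) _.
      apply: iid_conflict_le.
      + exact: measurable_ill_formed.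
      + exact: measurable_sample_overlap.
      + by rewrite !mulr_ge0 ?expR_ge0.
      + exact: ill_formed_le d_gt0 _ _ _ _.
      + by move=> s; apply: sample_overlap_le => //; exact: d_gt0.
    by rewrite lee_fin; exact: conflict_rate_le cT2 n_gt0 d_gt0 mcT delta0 delta2 dC C_omega.
  apply: le_trans (iid_count_tail _ _ mm (mislabeled_le _ _ _ _ _ _ _)) _ => //.
  rewrite lee_fin; apply: le_trans (mislabeled_rate eta0 kappa0 etak xk) _.
  exact: delta_pow.
- by apply: prob_setU_le;
    [exact: measurable_count|exact: measurable_count|exact: cls|exact: cls].
Qed.

Let A : R := theta * (n%:R / d%:R).

Lemma good_training_conclusion S (g L : R) : ~ bad_training S ->
  15 + 6 * (m%:R * (2 * n%:R + 3)) + 432 * (rho ^+ 2 * A) <= L -> g = expR (L / 2) ->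
  (forall i, (tnth S i).2 = 1 \/ (tnth S i).2 = -1) /\
  (exists v p, feasible S g v p) /\
  forall v p, is_solution S g v p ->
    [/\ forall c, g <= pm1 R c * dotp (if c then mu1 else mu2) v,
        forall c, L / 4 <= dotp (if c then mu1 else mu2) p,
        dotp v v <= 2 * g ^+ 2 * A &
        dotp p p <= 2 * L ^+ 2 * A].
Proof.
move=> nbad hL gE.
have nconf : ~ conflict (ill_formed t mu1 mu2) (sample_overlap rho t mu1 mu2) S.
  by move=> h; apply: nbad; left; left.
have nmis : \sum_i \1_mis (tnth S i) < kappa * n%:R :> R.
  by rewrite ltNge; apply/negP => h; apply: nbad; left; right.
have ncls c : \sum_i \1_(notc c) (tnth S i) < 3 / 4 * n%:R :> R.
  by rewrite ltNge; apply/negP => h; apply: nbad; right; case: c h; [left|right].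
have [b [pos wf]] := good_well_formed nconf.
have yb i : (tnth S i).2 = 1 \/ (tnth S i).2 = -1 by have [] := wf i.
split=> //.
have A0 : 0 <= rho ^+ 2 * A.
  by rewrite mulr_ge0 ?sqr_ge0// mulr_ge0 ?(ltW theta0)// divr_ge0.
have [L1 Lg Lm Lm2 Lrho] := large_margin A0 hL gE.
have kappa8 : kappa <= 8^-1.
  have : theta <= 1 by rewrite invf_le1; have := cT4; lra.
  by move=> ?; rewrite ler_pdivrMr//; lra.
apply: (@training_conclusion _ _ _ _ rho theta mu1 mu2 S b pos) => //.
- exact: n_gt0.
- exact: d_gt0.
- by move=> i; exact: well_formed_pos (wf i).
- exact: good_orth wf.
- exact: good_norm wf.
- exact: good_overlap nconf _ _ wf.
- rewrite ltf_pV2 ?posrE; have := cT4; lra.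
- rewrite (card_noisy rho0 mu12 mu1rho mu2rho wf).
  (* The signals take the other half of the budget, as [rho >= C * sqrt (d / n)] and
     [theta * C ^ 2 >= 16]. *)
  have h1 : 8 / rho ^+ 2 <= theta / 2 * (n%:R / d%:R).
    have sq : C ^+ 2 * (d%:R / n%:R) <= rho ^+ 2.
      rewrite -[X in _ * X]sqr_sqrtr ?divr_ge0// -exprMn ler_pXn2r ?nnegrE ?(ltW rho0)//.
      by rewrite mulr_ge0 ?sqrtr_ge0//; have := C64; lra.
    have Ct : 16 <= theta * C ^+ 2.
      have : 16 <= kappa * C by rewrite mulrC -ler_pdivrMr.
      have : kappa * C <= theta * C.
        rewrite ler_wpM2r//; first by have := C64; lra.
        by rewrite ler_pdivrMr//; have := theta0; lra.
      by have := C64; have := theta0; nra.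
    rewrite ler_pdivrMr ?exprn_gt0//.
    apply: (@le_trans _ _ (theta / 2 * (n%:R / d%:R) * (C ^+ 2 * (d%:R / n%:R)))).
      have -> : theta / 2 * (n%:R / d%:R) * (C ^+ 2 * (d%:R / n%:R)) = theta * C ^+ 2 / 2.
        by field; rewrite !gt_eqF// ; have := cT2; lra.
      lra.
    by rewrite ler_wpM2l// mulr_ge0 ?divr_ge0// ltW.
  have h2 : 5 * 128 ^+ 2 * ((\sum_i \1_mis (tnth S i)) / d%:R) <= theta / 2 * (n%:R / d%:R).
    rewrite [leLHS]mulrA [leRHS]mulrA ler_pM2r ?invr_gt0//.
    apply: (@le_trans _ _ (5 * 128 ^+ 2 * (kappa * n%:R))).
      by apply: ler_wpM2l; [lra|exact: ltW].
    by rewrite le_eqVlt; apply/orP; left; apply/eqP; field; have := cT2; lra.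
  lra.
- move=> c; apply: le_trans (card_clean_class rho0 mu12 mu1rho mu2rho wf c).
  have := ncls c; have := nmis; have := np; nra.
- by rewrite -mulrA; move: Lrho; rewrite -/A; lra.
Qed.

(** The scales [g] and [L] cancel: the exponents of [misclassified_le] are [1 / (16 * m ^ 2 * A)]
    and [1 / (64 * A)], both at least [100 * d / n] by the choice of [theta]. This is at least
    [100 * h], of which [99 * h] absorbs the union bound. *)
Lemma solution_error (g L : R) (v p : 'cV[R]_d) : 0 < g -> 0 < L ->
  (forall c, g <= pm1 R c * dotp (if c then mu1 else mu2) v) ->
  (forall c, L / 4 <= dotp (if c then mu1 else mu2) p) ->
  dotp v v <= 2 * g ^+ 2 * A -> dotp p p <= 2 * L ^+ 2 * A ->
  (Dn (misclassified v p) <= (eta + expR (- (d%:R / n%:R ^+ 2)))%:E)%E.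
Proof.
move=> g0 L0 hg hL hv hp.
have A0 : 0 < A by rewrite mulr_gt0 ?divr_gt0.
have m0 : (0 < m)%N by [].
have mp : 0 < m%:R :> R by rewrite ltr0n.
have mc : m%:R <= cT by apply: le_trans mcT; rewrite ler_nat.
apply: le_trans (misclassified_le eta0 eta1 m0 rho0 mu12 mu1rho mu2rho (V := 2 * g ^+ 2 * A)
  (W := 2 * L ^+ 2 * A) (L := L / 4) g0 _ _ _ hg hL hv hp) _.
- by rewrite divr_gt0.
- by apply: mulr_gt0 A0; rewrite mulr_gt0 ?exprn_gt0.
- by apply: mulr_gt0 A0; rewrite mulr_gt0 ?exprn_gt0.
rewrite lee_fin lerD2l.
set h := d%:R / n%:R ^+ 2.
have h0 : 0 < h by rewrite divr_gt0 ?exprn_gt0.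
have hdn : h <= d%:R / n%:R.
  rewrite ler_pM2l// lef_pV2 ?posrE ?exprn_gt0// expr2 ler_peMr ?(ltW np)//.
  by rewrite ler1n n_gt0.
have e1 : expR (- ((g / (2 * m%:R)) ^+ 2 / (2 * (2 * g ^+ 2 * A)))) <= expR (- (100 * h)).
  rewrite ler_expR lerN2.
  have -> : (g / (2 * m%:R)) ^+ 2 / (2 * (2 * g ^+ 2 * A)) =
      100 * (d%:R / n%:R) * (cT ^+ 2 / m%:R ^+ 2).
    by rewrite /A; field; rewrite !gt_eqF//; have := cT2; lra.
  apply: (@le_trans _ _ (100 * (d%:R / n%:R) * 1)); first by rewrite mulr1; lra.
  rewrite ler_wpM2l ?mulr_ge0 ?divr_ge0// ler_pdivlMr ?exprn_gt0// mul1r.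
  by rewrite ler_pXn2r ?nnegrE ?(ltW mp)// (le_trans (ltW mp)).
have e2 : expR (- ((L / 4) ^+ 2 / (2 * (2 * L ^+ 2 * A)))) <= expR (- (100 * h)).
  rewrite ler_expR lerN2.
  have -> : (L / 4) ^+ 2 / (2 * (2 * L ^+ 2 * A)) = 25 * (d%:R / n%:R) * cT ^+ 2.
    by rewrite /A; field; rewrite !gt_eqF//; have := cT2; lra.
  apply: (@le_trans _ _ (25 * (d%:R / n%:R) * 4)); first by lra.
  by rewrite ler_wpM2l ?mulr_ge0 ?divr_ge0.
have hcT := sqr_ratio_ge_cT cT2 n_gt0 delta0 delta2 dC C_omega.
apply: (@le_trans _ _ (m%:R * (3 * expR (- (100 * h))))).
  by rewrite ler_pM2l//; lra.
have -> : - (100 * h) = - (99 * h) - h by ring.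
rewrite expRD mulrA mulrA ler_piMl ?expR_ge0//.
rewrite expRN ler_pdivrMr ?expR_gt0// mul1r.
apply: le_trans (expR_ge1Dx _); rewrite -/h in hcT; have := cT2; lra.
Qed.

End good_event.

Theorem theorem10 (R : realType) (cT : R) (cT_ge2 : 2 <= cT) :
  exists C a1 a2 : R, [/\ 0 < C, 0 < a1, 0 < a2 &
  forall (d n m : nat) (delta rho eta : R) (mu1 mu2 : 'cV[R]_d),
    0 < delta -> delta < 2^-1 ->
    0 < rho -> dotp mu1 mu2 = 0 -> l2norm mu1 = rho -> l2norm mu2 = rho ->
    C * n%:R ^+ 2 * ln (n%:R / delta) <= d%:R ->
    C * ln (delta^-1) <= n%:R ->
    C * Num.sqrt (d%:R / n%:R) <= rho ->
    0 <= eta -> eta < 2^-1 -> eta <= C^-1 ->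
    (2 <= m.+1)%N -> m.+1%:R <= cT ->
    exists gamma0 : R, forall gamma : R, 0 < gamma -> gamma0 <= gamma ->
      with_prob_ge (iid_prob (D_noisy m rho mu1 mu2 eta) n) (1 - delta)
        (fun S : n.-tuple ('M[R]_(m.+1, d) * R) =>
          (exists v p, is_solution S gamma v p) /\
          forall v p : 'cV[R]_d, is_solution S gamma v p ->
            (forall i : 'I_n,
               (tnth S i).2 = Num.sg (attn (tnth S i).1 v p)) /\
            (D_noisy m rho mu1 mu2 eta
               [set s | s.2 <> Num.sg (attn s.1 v p)]
             <= (eta + expR (- (a1 * d%:R / n%:R ^+ 2))
                 + expR (- (a2 * (rho ^- 2 + eta * n%:R / d%:R)^-1)))%:E)%E)].
Proof.
pose theta : R := (40 ^+ 2 * cT ^+ 2)^-1.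
pose omega : R := (8 * 256 ^+ 2 * cT ^+ 2)^-1.
(* The summands serve the class counts, the conflicts, and the noisy samples in this order; the last
   also yields [eta <= kappa / 4]. *)
pose C := 64 + (2 + 20 * cT ^+ 2) / omega + 16 / (theta / (10 * 128 ^+ 2)).
have cT4 : 4 <= cT ^+ 2 by nra.
have theta0 : 0 < theta by rewrite invr_gt0; lra.
have omega0 : 0 < omega by rewrite invr_gt0; lra.
exists C, 1, 1; split => //.
  apply: addr_gt0; first by apply: addr_gt0; [|apply: divr_gt0]; lra.
  by apply: divr_gt0; [lra|apply: divr_gt0; lra].
move=> d n m delta rho eta mu1 mu2 delta0 delta2 rho0 mu12 mu1rho mu2rho dC nC rhoC
  eta0 eta2 etaC m2 mcT.
(* The threshold of [large_margin] does not involve the training set, so [gamma0] can be chosen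
   before the sample. *)
pose L0 : R := 15 + 6 * (m%:R * (2 * n%:R + 3)) +
  432 * (rho ^+ 2 * (theta * (n%:R / d%:R))).
exists (expR (L0 / 2)) => g g0 hg.
pose L := 2 * ln g.
have gE : g = expR (L / 2) by rewrite /L mulrAC divff// mul1r lnK.
have hL : L0 <= L by move: hg; rewrite gE ler_expR; lra.
have tpos : 0 <= rho ^+ 2 * (theta * (n%:R / d%:R)).
  by rewrite mulr_ge0 ?sqr_ge0// mulr_ge0 ?(ltW theta0)// divr_ge0.
have Lp : 0 < L.
  have k0 : 0 <= m%:R * (2 * n%:R + 3) :> R by rewrite mulr_ge0// addr_ge0// mulr_ge0.
  by apply: lt_le_trans hL; rewrite /L0; lra.
have cT2 := cT_ge2.
exists (~` bad_training cT rho mu1 mu2); split.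
- by apply: measurableC; exact: measurable_bad_training.
- move=> S nbad.
  have [ypm [[v0 [p0 f0]] hsol]] := good_training_conclusion cT2 (lexx C) delta0 delta2
    rho0 mu12 mu1rho mu2rho dC nC rhoC m2 nbad hL gE.
  split; first exact: solution_exists f0.
  move=> v p sol; have [hg' hL' hv hp] := hsol v p sol; split.
    move=> i; have [fe _] := sol; have := fe i.
    move=> /(lt_le_trans g0); set a := attn _ _ _.
    by case: (ypm i) => ->; rewrite ?mul1r ?mulN1r ?oppr_gt0 => h;
      rewrite ?(gtr0_sg h) ?(ltr0_sg h).
  apply: le_trans (solution_error cT2 (lexx C) delta0 delta2 rho0 mu12 mu1rho mu2rho
    dC nC eta0 eta2 m2 mcT g0 Lp hg' hL' hv hp) _.
  by rewrite lee_fin mul1r lerDl expR_ge0.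
- have mbad := @measurable_bad_training R cT rho d n m mu1 mu2.
  rewrite probability_setC// EFinB; apply: leeB => //.
  exact: (bad_training_le cT2 (lexx C) delta0 delta2 rho0 mu12 mu1rho
    mu2rho dC nC eta0 eta2 etaC mcT).
Qed.
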